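(* Let $w_0>0$. Assume $\mathscr S^{*}\neq\varnothing$, that $U$ satisfies the utility assumption, and that we are in the positive-wealth setting. If $U(+\infty):=\lim_{x\to+\infty}U(x)<+\infty$, then there exists $\hat\phi\in\mathcal A(w_0)$ such that $$u(w_0)=\inf_{S\in\mathscr S}\mathbb E_{\mathbb P}\big[U(W_T^S(w_0,\hat\phi))\big]<+\infty.$$
   Context: Fix $d,T\in\mathbb N$ and a filtered probability space $(\Omega,\mathcal F,\mathbb F=(\mathcal F_t)_{t=0}^T,\mathbb P)$ whose $\sigma$-algebras all contain the $\mathbb P$-null sets; random variables equal a.s. are identified. For $\mathcal G\subseteq\mathcal F$, $L^0(\mathcal G;\mathbb R^n)$ is the space of $\mathcal G$-measurable $\mathbb R^n$-valued random variables with the topology of convergence in probability. Let $\mathscr S$ be a nonempty family of $\mathbb F$-adapted $\mathbb R^d$-valued processes $S=(S_t)_{t=0}^T$, and write $\Delta S_t=S_t-S_{t-1}$. Let $\mathscr L=\prod_{t=1}^T L^0(\mathcal F_{t-1};\mathbb R^d)$. For $w\in\mathbb R$, $\phi\in\mathscr L$, $S\in\mathscr S$, set $W_t^S(w,\phi)=w+\sum_{s=1}^t\langle\phi_s,\Delta S_s\rangle$. For $S\in\mathscr S$ and $t\ge1$, $D_t^S(\omega)$ is the smallest affine subspace of $\mathbb R^d$ containing the support of the regular conditional distribution of $\Delta S_t$ given $\mathcal F_{t-1}$ at $\omega$. NA($S$) means: for every $\phi\in\mathscr L$, $W_T^S(0,\phi)\ge0$ a.s. implies $W_T^S(0,\phi)=0$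 a.s. $\mathscr S^{*}$ denotes the set of $S^*\in\mathscr S$ such that NA($S^*$) holds and, for every $S\in\mathscr S$ and $t$, $D_t^S\subseteq D_t^{S^*}$ a.s. Utility assumption: $U:\mathbb R\to\mathbb R\cup\{-\infty\}$ is non-decreasing, concave and upper semicontinuous. Positive-wealth setting: for every $S\in\mathscr S$, $\mathscr L(w_0,S)=\{\phi\in\mathscr L: W_t^S(w_0,\phi)\ge0\ \text{a.s. for all }t\in\{0,\ldots,T\}\}$, and the interior of $\{x:U(x)>-\infty\}$ is $(0,+\infty)$. Admissible set $\mathcal A(w_0)=\bigcap_{S\in\mathscr S}\mathscr L(w_0,S)$; value $u(w_0)=\sup_{\varphi\in\mathcal A(w_0)}\inf_{S\in\mathscr S}\mathbb E_{\mathbb P}[U(W_T^S(w_0,\varphi))]$, with the convention that the expectation of a random variable whose positive and negative parts both have infinite expectation is $-\infty$. *)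

(* Defs.v *)
From HB Require Import structures.
From mathcomp Require Import all_boot all_order all_algebra.
From mathcomp Require Import all_classical all_reals all_analysis.
Import Order.TTheory GRing.Theory Num.Theory.
Import numFieldNormedType.Exports.

Set Implicit Arguments.
Unset Strict Implicit.
Unset Printing Implicit Defensive.

Local Open Scope classical_set_scope.
Local Open Scope ring_scope.

(* R^d is modelled as the row vectors 'rV[R]_d, with its Euclidean (product)
   topology; its Borel sigma-algebra is the one generated by the open sets. *)
Definition BorelRd (R : realType) (d : nat) := g_sigma_algebraType (@open 'rV[R]_d).

Definition inner (R : realType) (d : nat) (x y : 'rV[R]_d) : R :=
  \sum_(i < d) x 0 i * y 0 i.

Definition meas_wrt (Om : Type) {d' : measure_display} {T' : measurableType d'}
  (G : set (set Om)) (f : Om -> T') : Prop :=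
  forall B : set T', measurable B -> G (f @^-1` B).

Section Setting.
Context (R : realType) (d : nat) (dO : measure_display) (Om : measurableType dO)
  (P : probability Om R).

Definition filtration (T : nat) (F : nat -> set (set Om)) : Prop :=
  (forall N : set Om, measurable N -> P N = 0%E -> forall M, M `<=` N -> measurable M)
  /\ (forall t, (t <= T)%N -> sigma_algebra setT (F t))
  /\ (forall t, (t <= T)%N -> F t `<=` measurable)
  /\ (forall s t, (s <= t)%N -> (t <= T)%N -> F s `<=` F t)
  /\ (forall t, (t <= T)%N -> forall N : set Om, measurable N -> P N = 0%E -> F t N).

Definition vec_meas (G : set (set Om)) (f : Om -> 'rV[R]_d) : Prop :=
  meas_wrt G (f : Om -> BorelRd R d).

Definition adapted (T : nat) (F : nat -> set (set Om)) (S : nat -> Om -> 'rV[R]_d) : Prop :=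
  forall t, (t <= T)%N -> vec_meas (F t) (S t).

Definition predictable (T : nat) (F : nat -> set (set Om)) (phi : nat -> Om -> 'rV[R]_d) : Prop :=
  forall s, (1 <= s <= T)%N -> vec_meas (F s.-1) (phi s).

Definition incr (S : nat -> Om -> 'rV[R]_d) (t : nat) (w : Om) : 'rV[R]_d :=
  S t w - S t.-1 w.

Definition wealth (S : nat -> Om -> 'rV[R]_d) (w : R) (phi : nat -> Om -> 'rV[R]_d)
  (t : nat) (om : Om) : R :=
  w + \sum_(1 <= s < t.+1) inner (phi s om) (incr S s om).

Definition NA (T : nat) (F : nat -> set (set Om)) (S : nat -> Om -> 'rV[R]_d) : Prop :=
  forall phi, predictable T F phi ->
    {ae P, forall om, 0 <= wealth S 0 phi T om} ->
    {ae P, forall om, wealth S 0 phi T om = 0}.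

Definition is_rcd (G : set (set Om)) (X : Om -> 'rV[R]_d)
  (K : Om -> probability (BorelRd R d) R) : Prop :=
  (forall B : set (BorelRd R d), measurable B -> meas_wrt G (fun om => fine (K om B)))
  /\ (forall (A : set Om) (B : set (BorelRd R d)), G A -> measurable B ->
        P (A `&` (X : Om -> BorelRd R d) @^-1` B) = (\int[P]_(om in A) K om B)%E).

Definition support (mu : probability (BorelRd R d) R) : set 'rV[R]_d :=
  [set x | forall O : set 'rV[R]_d, open O -> O x -> (0 < mu O)%E].

Definition affine_set (V : set 'rV[R]_d) : Prop :=
  forall x y (l : R), V x -> V y -> V (l *: x + (1 - l) *: y).

Definition affine_hull (A : set 'rV[R]_d) : set 'rV[R]_d :=
  [set x | forall V, affine_set V -> A `<=` V -> V x].

(* D_t^S(om) = affine hull of the support of the r.c.d. of Delta S_t given F_{t-1} at om;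
   "D_t^S ⊆ D_t^{S'} a.s.", for (any) versions of the regular conditional distributions *)
Definition D_incl (F : nat -> set (set Om)) (S S' : nat -> Om -> 'rV[R]_d) (t : nat) : Prop :=
  forall K K', is_rcd (F t.-1) (incr S t) K -> is_rcd (F t.-1) (incr S' t) K' ->
    {ae P, forall om, affine_hull (support (K om)) `<=` affine_hull (support (K' om))}.

Definition Sstar (T : nat) (F : nat -> set (set Om)) (SS : set (nat -> Om -> 'rV[R]_d))
  (Ss : nat -> Om -> 'rV[R]_d) : Prop :=
  SS Ss /\ NA T F Ss /\
  (forall S, SS S -> forall t, (1 <= t <= T)%N -> D_incl F S Ss t).

Definition expect (X : Om -> \bar R) : \bar R :=
  let p := (\int[P]_om (X^\+ om))%E in
  let n := (\int[P]_om (X^\- om))%E in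
  if (p == +oo%E) && (n == +oo%E) then -oo%E else (p - n)%E.

Definition Lpos (T : nat) (F : nat -> set (set Om)) (w0 : R) (S : nat -> Om -> 'rV[R]_d)
  (phi : nat -> Om -> 'rV[R]_d) : Prop :=
  predictable T F phi /\
  forall t, (t <= T)%N -> {ae P, forall om, 0 <= wealth S w0 phi t om}.

Definition Adm (T : nat) (F : nat -> set (set Om)) (SS : set (nat -> Om -> 'rV[R]_d)) (w0 : R)
  (phi : nat -> Om -> 'rV[R]_d) : Prop :=
  predictable T F phi /\ forall S, SS S -> Lpos T F w0 S phi.

Definition worst_case (T : nat) (SS : set (nat -> Om -> 'rV[R]_d)) (U : R -> \bar R) (w0 : R)
  (phi : nat -> Om -> 'rV[R]_d) : \bar R :=
  ereal_inf [set expect (fun om => U (wealth S w0 phi T om)) | S in SS].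

Definition value (T : nat) (F : nat -> set (set Om)) (SS : set (nat -> Om -> 'rV[R]_d))
  (U : R -> \bar R) (w0 : R) : \bar R :=
  ereal_sup [set worst_case T SS U w0 phi | phi in Adm T F SS w0].

End Setting.

Definition utility (R : realType) (U : R -> \bar R) : Prop :=
  (forall x, U x != +oo%E)
  /\ (forall x y, x <= y -> (U x <= U y)%E)
  /\ (forall x y (l : R), 0 < l < 1 ->
        (l%:E * U x + (1 - l)%R%:E * U y <= U (l * x + (1 - l) * y)%R)%E)
  /\ (forall (x a : R), (U x < a%:E)%E -> \forall y \near x, (U y < a%:E)%E).

Definition positive_domain (R : realType) (U : R -> \bar R) : Prop :=
  interior [set x : R | (-oo < U x)%E] = [set x : R | 0 < x].

(* Main.v *)
(* Let Ss be an element of the family satisfying NA and dominating the affine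
   hulls D_t^S.  A predictable nu with <nu_t, Delta Ss_t> = 0 a.s. also satisfies
   <nu_t, Delta S_t> = 0 a.s. for every S in the family, so each strategy may be
   replaced, without changing any wealth process, by its component orthogonal to
   these null strategies.  For orthogonal strategies with nonnegative Ss-wealth,
   NA(Ss) yields by induction on time an a.s. finite bound that does not depend on
   the strategy.  With a weight built from this bound, the almost optimal
   orthogonal strategies form a decreasing sequence of convex sets meeting a ball
   of a weighted L^2 space; almost minimal-norm elements of these sets converge
   a.s. by the parallelogram identity.  Since U is bounded above and upper
   semicontinuous, Fatou's lemma shows that the limit is optimal.  The same
   minimal-norm argument gives the orthogonal decomposition, and the compactness
   step in the boundedness proof. *)
Require Import Defs.
From HB Require Import structures.
From mathcomp Require Import all_boot all_order all_algebra.
From mathcomp Require Import all_classical all_reals all_analysis.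
From mathcomp Require Import measurable_realfun ring lra.
Import Order.TTheory GRing.Theory Num.Theory.
Import numFieldNormedType.Exports.
Local Open Scope classical_set_scope.
Local Open Scope ring_scope.
Set Implicit Arguments.
Unset Strict Implicit.
Unset Printing Implicit Defensive.

(** * Measurability with respect to a sub-sigma-algebra *)

(** The hull inclusion [D_incl] quantifies over all versions of the conditional laws, so it gives
    information only once such versions are known to exist. This is why regular conditional
    distributions are constructed before anything financial. The family [SS] may be uncountable, so
    the wealth processes have no common null set. The limit is therefore taken in the strategies:
    one a.e. convergence of their finitely many coordinates gives a.e. convergence of the wealth
    under each [S]. Pointwise bounds alone give convergent subsequences only along indices that
    depend on the outcome. Almost minimizing a strictly convex norm selects instead a sequence with
    deterministic indices. The weight in this norm is measurable for the full sigma-algebra and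
    anticipates the future; predictability survives because the limit is formed coordinatewise,
    separately at each time. *)

Section SubSigmaAlgebra.
Context (dO : measure_display) (Om : measurableType dO).

(** Bridge to the general measurability lemmas: [g_sigma_algebraType G] is [Om] with a second
    measurable structure, and its measurable sets are those of [G] because [G] is already a
    sigma-algebra. *)
Lemma meas_wrtP (d' : measure_display) (T' : measurableType d')
    (G : set (set Om)) (f : Om -> T') : sigma_algebra setT G ->
  meas_wrt G f <-> measurable_fun setT (f : g_sigma_algebraType G -> T').
Proof.
move=> sG; split=> [mf _ B mB|mf B mB].
  by rewrite setTI; apply: sub_sigma_algebra; exact: mf.
have := mf measurableT B mB.
by rewrite setTI /measurable/= sigma_algebra_id.
Qed.

Lemma sub_measurable_fun (d' : measure_display) (T' : measurableType d')
    (G : set (set Om)) (f : Om -> T') :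
  sigma_algebra setT G -> G `<=` measurable ->
  measurable_fun setT (f : g_sigma_algebraType G -> T') -> measurable_fun setT f.
Proof.
move=> sG Gm /(meas_wrtP _ sG) mf _ B mB; rewrite setTI; apply: Gm; exact: mf.
Qed.

End SubSigmaAlgebra.

(** * Borel sets of row vectors *)

Section BorelVectors.
Context (R : realType) (d : nat).

(** The point is the countable index type: open sets become countable unions, and what holds a.e.
    for each index holds a.e. for all indices together. *)
Definition rat_ball (qn : 'rV[rat]_d * nat) : set 'rV[R]_d :=
  ball (map_mx ratr qn.1 : 'rV[R]_d) (qn.2.+1%:R^-1).

Lemma rat_ballP (qn : 'rV[rat]_d * nat) (x : 'rV[R]_d) :
  rat_ball qn x <-> forall i, `|ratr (qn.1 0 i) - x 0 i| < qn.2.+1%:R^-1.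
Proof.
rewrite /rat_ball; split.
  by move=> [_ /(_ 0)] + i => /(_ i); rewrite mxE.
move=> h; split; first by rewrite invr_gt0.
by move=> i j; rewrite mxE (ord1 i); exact: h.
Qed.

Lemma open_rat_ball qn : open (rat_ball qn).
Proof. exact: ball_open. Qed.

Lemma rat_ball_around (x : 'rV[R]_d) (n : nat) : exists q, rat_ball (q, n) x.
Proof.
have n0 : (0 : R) < n.+1%:R^-1 by rewrite invr_gt0.
have /choice[q hq] : forall i : 'I_d, exists q : rat,
    ratr q \in `](x 0 i - n.+1%:R^-1), (x 0 i + n.+1%:R^-1)[.
  by move=> i; apply: rat_in_itvoo; rewrite ltrBlDr -addrA ltrDl addr_gt0.
exists (\row_i q i); apply/rat_ballP => i; rewrite mxE /=.
by have := hq i; rewrite in_itv/= -ltr_distl.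
Qed.

Lemma rat_ball_base (x : 'rV[R]_d) (O : set 'rV[R]_d) : open O -> O x ->
  exists2 qn, rat_ball qn x & rat_ball qn `<=` O.
Proof.
move=> oO Ox; have /nbhs_ballP[e /= e0 eO] := open_nbhs_nbhs (conj oO Ox).
have [n ne] : exists n : nat, n.+1%:R^-1 < e / 2.
  have e2 : (0 : R) < e / 2 by move: e0; lra.
  by have [n] := ltr_add_invr e2; rewrite add0r => ne; exists n.
have [q xq] := rat_ball_around x n; exists (q, n) => //.
move=> y /rat_ballP yq; apply: eO; split => // i j; rewrite (ord1 i) {i}.
rewrite /ball/= -(subrKA (ratr (q 0 j))) (le_lt_trans (ler_normD _ _))//.
rewrite (splitr e); apply: ltrD; apply: lt_trans ne; last exact: yq.
by rewrite distrC; move/rat_ballP: xq.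
Qed.

Lemma open_bigcup_rat_ball (O : set 'rV[R]_d) : open O ->
  O = \bigcup_(qn in [set qn | rat_ball qn `<=` O]) rat_ball qn.
Proof.
move=> oO; apply/seteqP; split=> [x Ox|x [qn /= qnO]]; last exact: qnO.
by have [qn ? ?] := rat_ball_base oO Ox; exists qn.
Qed.

Lemma measurable_coord (i : 'I_d) :
  measurable_fun setT ((fun x => x 0 i) : BorelRd R d -> R).
Proof.
apply: (measurability _ (RGenOInfty.measurableE R)).
move=> _ [_ [a ->] <-]; rewrite setTI.
apply: sub_sigma_algebra; apply: open_comp; last exact: interval_open.
by move=> x _; exact: coord_continuous.
Qed.

(** An open set is a countable union of rational balls, and a ball for the sup norm is a finite
    intersection of conditions on single coordinates. *)
Lemma measurable_rowP (d1 : measure_display) (T1 : measurableType d1)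
    (f : T1 -> 'rV[R]_d) :
  measurable_fun setT (f : T1 -> BorelRd R d) <->
  forall i, measurable_fun setT (fun x => f x 0 i).
Proof.
split=> [mf i|mf].
  exact: (measurableT_comp (measurable_coord i) mf).
apply: (measurability _ (erefl (measurable : set (set (BorelRd R d))))).
move=> _ [V oV <-]; rewrite setTI (open_bigcup_rat_ball oV) preimage_bigcup.
rewrite bigcup_mkcond; apply: countable_bigcupT_measurable => [|qn].
  exact: countableP.
case: ifPn => // _.
have -> : f @^-1` rat_ball qn = \bigcap_(i in [set: 'I_d])
   ((fun x => f x 0 i) @^-1` [set y | `|ratr (qn.1 0 i) - y| < qn.2.+1%:R^-1]).
  apply/seteqP; split => x /=.
    by move=> /rat_ballP h i _; exact: h.
  by move=> h; apply/rat_ballP => i; exact: h.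
apply: fin_bigcap_measurable => [|i _]; first exact: finite_finset.
rewrite -[X in measurable X]setTI.
apply: mf => //.
rewrite (_ : mkset _ = ball (ratr (qn.1 0 i) : R) (qn.2.+1%:R^-1)) //.
exact: measurable_ball.
Qed.

End BorelVectors.

(** * Almost minimizers over decreasing convex sets *)

(** The term in [z] may be cancelled only if it is finite; an infinite [D] or [z] would make the
    left side infinite while [x] and [y] are bounded. *)
Lemma parallelogram_defect_le (R : realType) (D x y z : \bar R) (p q s : R) :
  (0 <= D)%E -> (0 <= x)%E -> (0 <= y)%E -> (0 <= z)%E ->
  (D + 4%:E * z = 2%:E * x + 2%:E * y)%E ->
  (x <= p%:E)%E -> (y <= q%:E)%E -> (s%:E <= z)%E ->
  (D <= (2 * p + 2 * q - 4 * s)%:E)%E.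
Proof.
case: D x y z => [D| |] [x| |] [y| |] [z| |]//;
  rewrite -?EFinM -?EFinD ?lee_fin.
- by move=> ? ? ? ? [?] ? ? ?; lra.
- by rewrite gt0_muley// lte_fin.
- by rewrite gt0_muley// lte_fin.
Qed.

Section NearMinimizers.
Context (R : realType) (dO : measure_display) (Om : measurableType dO).
Variables (mu : {measure set Om -> \bar R}) (I : finType) (V : Type).
Variables (c : V -> I -> Om -> R) (mid : V -> V -> V) (w : Om -> R).
Hypothesis midE : forall x y i om, c (mid x y) i om = (c x i om + c y i om) / 2.
Hypothesis w_gt0 : forall om, 0 < w om.
Hypothesis mw : measurable_fun setT w.

(** The vectors are kept abstract, with coordinates [c] and midpoint [mid], so that the same
    argument serves one-period vectors (coordinates in ['I_d]) and whole strategies (coordinates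
    indexed by period and component). *)
Definition wsq (f : I -> Om -> R) (om : Om) : R :=
  w om * \sum_i (f i om) ^+ 2.

Definition wnorm (v : V) : \bar R := (\int[mu]_om (wsq (c v) om)%:E)%E.

Lemma wsq_ge0 f om : 0 <= wsq f om.
Proof.
by rewrite mulr_ge0 ?(ltW (w_gt0 _))// sumr_ge0// => i _; rewrite sqr_ge0.
Qed.

Lemma measurable_wsq f : (forall i, measurable_fun setT (f i)) ->
  measurable_fun setT (wsq f).
Proof.
move=> mf; apply: measurable_funM => //; apply: measurable_sum => i.
exact: measurable_funX.
Qed.

Lemma wsq_parallelogram x y om :
  wsq (fun i om => c x i om - c y i om) om + 4 * wsq (c (mid x y)) om =
  2 * wsq (c x) om + 2 * wsq (c y) om.
Proof.
rewrite /wsq (mulrCA 4) !(mulrCA 2) -!mulrDr; congr (_ * _).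
rewrite !mulr_sumr -!big_split/= mulr_sumr; apply: eq_bigr => i _.
by rewrite midE; field.
Qed.

Lemma wnorm_parallelogram x y : (forall i, measurable_fun setT (c x i)) ->
  (forall i, measurable_fun setT (c y i)) ->
  (\int[mu]_om (wsq (fun i om => c x i om - c y i om) om)%:E
   + 4%:E * wnorm (mid x y) = 2%:E * wnorm x + 2%:E * wnorm y)%E.
Proof.
move=> mx my; have mm i : measurable_fun setT (c (mid x y) i).
  rewrite (_ : c _ i = fun om => (c x i om + c y i om) / 2).
    by apply: measurable_funM => //; exact: measurable_funD.
  by apply/funext => om; exact: midE.
have mB i : measurable_fun setT (fun om => c x i om - c y i om).
  exact: measurable_funB.
rewrite /wnorm -!ge0_integralZl_EFin//; try by
  [move=> *; rewrite lee_fin wsq_ge0|exact/measurable_EFinP/measurable_wsq].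
rewrite -!ge0_integralD//; try by
  [move=> *; rewrite ?mule_ge0 ?lee_fin ?wsq_ge0|exact/measurable_EFinP/measurable_wsq
  |apply: measurable_funeM; exact/measurable_EFinP/measurable_wsq].
apply: eq_integral => om _; rewrite -!EFinM -!EFinD; congr (_%:E).
exact: wsq_parallelogram.
Qed.

(* Almost minimizers of the weighted norm over a decreasing sequence of
   midpoint-convex sets form, by the parallelogram identity, a Cauchy sequence
   in the weighted L^2 space; the geometric rate makes it converge a.e. *)
Lemma near_minimizers_cvg (C : nat -> set V) (M : R) :
  (forall n, C n.+1 `<=` C n) ->
  (forall n x y, C n x -> C n y -> C n (mid x y)) ->
  (forall n x, C n x -> forall i, measurable_fun setT (c x i)) ->
  (forall n, exists2 x, C n x & (wnorm x <= M%:E)%E) ->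
  exists v : nat -> V, [/\ forall n, C n (v n),
    {ae mu, forall om, forall i, cvgn (fun n => c (v n) i om)} &
    forall r : R, (forall n, exists2 x, C n x & (wnorm x <= r%:E)%E) ->
      forall k, (wnorm (v k) <= (r + 16^-1 ^+ k.+1)%:E)%E].
Proof.
move=> Cdec Cmid Cmeas CM.
have Cle n p : (n <= p)%N -> C p `<=` C n.
  move=> /subnKC <-; elim: (p - n)%N => [|q IH]; first by rewrite addn0.
  by rewrite addnS => x /Cdec; exact: IH.
have wn0 x : (0 <= wnorm x)%E.
  by apply: integral_ge0 => om _; rewrite lee_fin wsq_ge0.
pose m n := ereal_inf (wnorm @` C n).
have m_le n x : C n x -> (m n <= wnorm x)%E.
  by move=> Cx; apply: ereal_inf_lbound; exists x.
have m0 n : (0 <= m n)%E by apply: le_ereal_inf_tmp => _ [x _ <-].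
have mM n r : (exists2 x, C n x & (wnorm x <= r%:E)%E) -> (m n <= r%:E)%E.
  by move=> [x Cx]; apply: le_trans; exact: m_le.
have mnd n p : (n <= p)%N -> (m n <= m p)%E.
  by move=> np; apply: ereal_inf_le_tmp => _ [x Cx <-]; exists x => //; exact: Cle Cx.
pose ms := ereal_sup (range m).
have msr r : (forall n, exists2 x, C n x & (wnorm x <= r%:E)%E) -> (ms <= r%:E)%E.
  by move=> Cr; apply: ge_ereal_sup => _ [n _ <-]; exact: mM.
have m_ms n : (m n <= ms)%E by apply: ereal_sup_ubound; exists n.
have msfin : ms \is a fin_num.
  rewrite ge0_fin_numE; first exact: le_lt_trans (msr _ CM) (ltry _).
  exact: le_trans (m0 0%N) (m_ms _).
pose a := fine ms; have aE : ms = a%:E by rewrite fineK.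
(* The squared distance of consecutive terms will be at most [8 * eps k], which stays summable
   against the factor [4 ^+ k]; that factor makes the distances themselves decay like
   [2^-1 ^+ k]. *)
pose eps (k : nat) : R := 16^-1 ^+ k.+1.
have eps_gt0 k : 0 < eps k by rewrite exprn_gt0// invr_gt0.
have epsS k : eps k.+1 <= eps k.
  rewrite /eps exprS ler_piMl// ?exprn_ge0 ?invr_ge0//.
  by rewrite invf_le1// ler1n.
(* The index [nv.1] is so large that the infimum over [C nv.1] is within [eps k] of the limiting
   infimum [a]. *)
have : forall k, exists nv : nat * V, [/\ (k <= nv.1)%N,
    ((a - eps k)%:E <= m nv.1)%E, C nv.1 nv.2 & (wnorm nv.2 <= (a + eps k)%:E)%E].
  move=> k.
  have : ((a - eps k)%:E < ms)%E by rewrite aE lte_fin ltrBlDr ltrDl.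
  move=> /ereal_sup_gt[_ [n _ <-] mn].
  have : (m (maxn n k) < (a + eps k)%:E)%E.
    by rewrite (le_lt_trans (m_ms _))// aE lte_fin ltrDl.
  move=> /ereal_inf_lt[_ [x Cx <-] xa].
  exists (maxn n k, x); split => //=; first exact: leq_maxr.
    by rewrite (le_trans (ltW mn))// mnd// leq_maxl.
  exact: ltW.
move=> /choice[nv nvP].
pose v k := (nv k).2.
have vC k : C k (v k) by have [kn _ + _] := nvP k; exact: Cle.
have vM k : (wnorm (v k) <= (a + eps k)%:E)%E by have [] := nvP k.
have mv k i : measurable_fun setT (c (v k) i) by exact: Cmeas (vC k) _.
pose Dl k (i : I) om := c (v k) i om - c (v k.+1) i om.
have mDl k i : measurable_fun setT (Dl k i) by exact: measurable_funB.
have Dl_le k : (\int[mu]_om (wsq (Dl k) om)%:E <= (8 * eps k)%:E)%E.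
  have [nk1 ak Ck vk] := nvP k; have [nk2 ak' Ck' vk'] := nvP k.+1.
  (* Both vectors, hence their midpoint, lie in the larger set [C j], where the infimum is at least
     [a - eps k] whichever index is smaller. The parallelogram defect is then at most
     [6 * eps k + 2 * eps k.+1]. *)
  pose j := minn (nv k).1 (nv k.+1).1.
  have mj : ((a - eps k)%:E <= m j)%E.
    rewrite /j; have [_|_] := leqP (nv k).1 (nv k.+1).1; first by [].
    by apply: le_trans ak'; rewrite lee_fin lerB.
  have Cm : C j (mid (v k) (v k.+1)).
    by apply: Cmid; [apply: Cle Ck; exact: geq_minl|apply: Cle Ck'; exact: geq_minr].
  have Nm := le_trans mj (m_le _ _ Cm).
  have D0 : (0 <= \int[mu]_om (wsq (Dl k) om)%:E)%E.
    by apply: integral_ge0 => om _; rewrite lee_fin wsq_ge0.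
  have := parallelogram_defect_le D0 (wn0 _) (wn0 _) (wn0 _)
    (wnorm_parallelogram (mv k) (mv k.+1)) vk vk' Nm.
  by move=> /le_trans; apply; rewrite lee_fin; have := epsS k; lra.
have sumfin : (\int[mu]_om (\sum_(0 <= k <oo) (4 ^+ k * wsq (Dl k) om)%:E) < +oo)%E.
  rewrite integral_nneseries//; first last.
  - by move=> n om _; rewrite lee_fin mulr_ge0 ?exprn_ge0 ?wsq_ge0.
  - move=> n; apply/measurable_EFinP; apply: measurable_funM => //.
    exact: measurable_wsq.
  apply: (@le_lt_trans _ _ (\sum_(0 <= k <oo) (1 / (2 ^ k.+1)%:R)%:E)%E).
    apply: lee_nneseries => k _.
      move=> _; apply: integral_ge0 => om _.
      by rewrite lee_fin mulr_ge0 ?exprn_ge0 ?wsq_ge0.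
    under eq_integral do rewrite EFinM.
    rewrite ge0_integralZl_EFin//; last 2 first.
    - by move=> om _; rewrite lee_fin wsq_ge0.
    - exact/measurable_EFinP/measurable_wsq.
    apply: (@le_trans _ _ ((4 ^+ k)%:E * (8 * eps k)%:E)%E).
      by rewrite lee_pmul2l// lte_fin exprn_gt0.
    rewrite -EFinM lee_fin /eps div1r natrX !exprS.
    have -> : 4 ^+ k * (8 * (16^-1 * 16^-1 ^+ k)) = 2^-1 * (4 * 16^-1) ^+ k :> R.
      by rewrite exprMn; move: (4 ^+ k) (16^-1 ^+ k) => X Y; field.
    rewrite invfM ler_pM2l ?invr_gt0// -exprVn.
    by apply: lerXn2r; rewrite ?nnegrE; lra.
  by rewrite (le_lt_trans (epsilon_trick0 _ _))// ltry.
exists v; split => //; last first.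
  move=> r Cr k; rewrite (le_trans (vM k))// lee_fin lerD2r -lee_fin -aE.
  exact: msr.
have mF : measurable_fun setT
    (fun om => (\sum_(0 <= k <oo) (4 ^+ k * wsq (Dl k) om)%:E))%E.
  apply: ge0_emeasurable_sum => [k om _ _|k _].
    by rewrite lee_fin mulr_ge0 ?exprn_ge0 ?wsq_ge0.
  apply/measurable_EFinP; apply: measurable_funM => //; exact: measurable_wsq.
have F0 om : (0 <= \sum_(0 <= k <oo) (4 ^+ k * wsq (Dl k) om)%:E)%E.
  by apply: nneseries_ge0 => k _ _; rewrite lee_fin mulr_ge0 ?exprn_ge0 ?wsq_ge0.
have /integrable_ae : mu.-integrable setT
    (fun om => (\sum_(0 <= k <oo) (4 ^+ k * wsq (Dl k) om)%:E))%E.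
  apply/integrableP; split => //; under eq_integral do rewrite gee0_abs//.
  exact: sumfin.
move=> /(_ measurableT); apply: filterS => om /(_ Logic.I) Ffin i.
pose r := fine (\sum_(0 <= k <oo) (4 ^+ k * wsq (Dl k) om)%:E)%E.
have r0 : 0 <= r by rewrite fine_ge0.
have Dlr k : 4 ^+ k * Dl k i om ^+ 2 <= r / w om.
  rewrite ler_pdivlMr//.
  apply: (@le_trans _ _ (4 ^+ k * wsq (Dl k) om)).
    rewrite -mulrA ler_pM2l ?exprn_gt0// /wsq mulrC ler_pM2l//.
    by rewrite (bigD1 i)//= lerDl sumr_ge0// => *; rewrite sqr_ge0.
  rewrite -lee_fin /r fineK//.
  have := @nneseries_lim_ge _ (fun k => (4 ^+ k * wsq (Dl k) om)%:E) xpredT 0 k.+1.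
  rewrite big_nat_recr//=; move=> h; apply: le_trans (h _).
    rewrite leeDr// sume_ge0// => *.
    by rewrite lee_fin mulr_ge0 ?exprn_ge0 ?wsq_ge0.
  by move=> *; rewrite lee_fin mulr_ge0 ?exprn_ge0 ?wsq_ge0.
(* With [t = 2 ^+ k * |Dl k i om|] and [rho = r / w om], the previous bound reads [t ^+ 2 <= rho];
   it is weakened to [t <= 1 + rho] to avoid a square root. *)
have Dlb k : `|Dl k i om| <= geometric (1 + r / w om) 2^-1 k.
  rewrite /geometric/= exprVn ler_pdivlMr ?exprn_gt0//.
  have := Dlr k; have -> : (4 : R) = 2 ^+ 2 by ring.
  rewrite -exprM mulnC exprM -exprMn -(real_normK (num_real _)) normrM.
  rewrite (gtr0_norm (exprn_gt0 _ _))// mulrC.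
  move: (_ * _) (r / _) => t rho; nra.
have : cvgn (series (telescope (fun n => c (v n) i om))).
  apply: normed_cvg.
  apply: (@series_le_cvg _ _ (geometric (1 + r / w om) 2^-1)) => //=.
  - by move=> n; exact: le_trans (Dlb n).
  - by move=> n; rewrite /telescope/= distrC; exact: Dlb.
  - apply: is_cvg_geometric_series; rewrite gtr0_norm ?invr_gt0//; lra.
move=> h; rewrite (_ : (fun n => _) =
  (fun n => c (v 0%N) i om + series (telescope (fun n => c (v n) i om)) n)).
  by apply: is_cvgD => //; exact: is_cvg_cst.
by apply/funext => n; rewrite -eq_sum_telescope.
Qed.

End NearMinimizers.

(** * Regular conditional distributions *)

(** On the set where [g < f] the two integrals differ by the integral of the positive function
    [f - g]. Finiteness of the integral of [g] allows cancellation, so this integral is 0 and the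
    set is null. *)
Lemma le_ae_of_integral (d : measure_display) (T : measurableType d) (R : realType)
    (mu : {measure set T -> \bar R}) (f g : T -> R) :
  measurable_fun setT f -> measurable_fun setT g ->
  (forall x, 0 <= f x) -> (forall x, 0 <= g x) ->
  (\int[mu]_x (g x)%:E < +oo)%E ->
  (forall A, measurable A ->
     (\int[mu]_(x in A) (f x)%:E <= \int[mu]_(x in A) (g x)%:E)%E) ->
  {ae mu, forall x, f x <= g x}.
Proof.
move=> mf mg f0 g0 goo fg.
pose A := [set x | g x < f x].
have mA : measurable A.
  rewrite -[A]setTI (_ : A = (fun x => f x - g x) @^-1` `]0, +oo[).
    by apply: measurable_funB.
  by apply/seteqP; split=> x /=; rewrite in_itv/= andbT subr_gt0.
have mfA h : measurable_fun setT h -> measurable_fun A (fun x => (h x)%:E : \bar R).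
  by move=> mh; apply: measurable_funTS; exact/measurable_EFinP.
have AB : (\int[mu]_(x in A) (g x)%:E + \int[mu]_(x in A) `|(f x - g x)%:E| =
           \int[mu]_(x in A) (f x)%:E)%E.
  rewrite -ge0_integralD//; first last.
  - by apply: measurableT_comp => //; apply: mfA; exact: measurable_funB.
  - exact: mfA.
  - by move=> *; rewrite lee_fin.
  apply: eq_integral => x; rewrite inE /A/= => gf.
  by rewrite -EFinD gtr0_norm ?subr_gt0// subrKC.
have gA : (\int[mu]_(x in A) (g x)%:E < +oo)%E.
  apply: le_lt_trans goo; apply: ge0_subset_integral => //.
  - exact/measurable_EFinP.
  - by move=> *; rewrite lee_fin.
have : (\int[mu]_(x in A) `|(f x - g x)%:E| = 0)%E.
  have := fg A mA; rewrite -AB.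
  have : (0 <= \int[mu]_(x in A) (g x)%:E)%E.
    by apply: integral_ge0 => *; rewrite lee_fin.
  have : (0 <= \int[mu]_(x in A) `|(f x - g x)%:E|)%E by apply: integral_ge0.
  move: gA; case: (\int[mu]_(x in A) (g x)%:E)%E => [a| |]//.
  case: (\int[mu]_(x in A) _)%E => [b| |]//; rewrite ?lee_fin -?EFinD ?lee_fin => _.
  by move=> b0 _; rewrite gerDl => b0'; congr (_%:E); apply/eqP; rewrite eq_le b0'.
move=> /(ae_eq_integral_abs mu mA (mfA _ (measurable_funB mf mg))).
apply: filterS => x /= h; rewrite leNgt; apply/negP => gf.
by have := h gf => -[/eqP]; rewrite subr_eq0 => /eqP fgE; rewrite fgE ltxx in gf.
Qed.

Section CondProb.
Context (R : realType) (dO : measure_display) (Om : measurableType dO).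
Variables (P : probability Om R) (G : set (set Om)).
Hypotheses (sG : sigma_algebra setT G) (Gm : G `<=` measurable).

Lemma measurable_gE (A : set Om) :
  measurable (A : set (g_sigma_algebraType G)) <-> G A.
Proof. by rewrite {1}/measurable/= sigma_algebra_id. Qed.

(** The identity, viewed as a map from the full sigma-algebra to [G]; the image of [P] under it is
    the restriction of [P] to [G]. *)
Definition sub_incl (om : Om) : g_sigma_algebraType G := om.

Lemma measurable_sub_incl : measurable_fun setT sub_incl.
Proof. by move=> _ B /measurable_gE GB; rewrite setTI; exact: Gm. Qed.

Definition sub_mfun : {mfun Om >-> g_sigma_algebraType G} :=
  HB.pack sub_incl (isMeasurableFun.Build _ _ _ _ _ measurable_sub_incl).

Definition sub_prob : probability (g_sigma_algebraType G) R :=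
  distribution P sub_mfun.

Lemma integral_sub_prob (A : set Om) (f : g_sigma_algebraType G -> \bar R) :
  G A -> measurable_fun setT f -> (forall x, 0 <= f x)%E ->
  (\int[sub_prob]_(x in A) f x = \int[P]_(x in A) f x)%E.
Proof.
move=> GA mf f0; rewrite (ge0_integral_pushforward measurable_sub_incl)//.
- exact/measurable_gE.
- exact: measurable_funTS.
Qed.

Section TraceMeasure.
Variables (E : set Om) (mE : measurable E).

Definition trace_measure (A : set (g_sigma_algebraType G)) : \bar R := P (A `&` E).

Let trace0 : trace_measure set0 = 0%E.
Proof. by rewrite /trace_measure set0I measure0. Qed.

Let trace_ge0 A : (0 <= trace_measure A)%E.
Proof. exact: measure_ge0. Qed.

Let trace_sigma_additive : semi_sigma_additive trace_measure.
Proof.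
move=> F mF tF mUF; apply: (@measure_semi_sigma_additive _ _ _ (mrestr P mE)) => //.
- by move=> n; apply/Gm/measurable_gE.
- exact/Gm/measurable_gE.
Qed.

HB.instance Definition _ := isMeasure.Build _ _ _ trace_measure
  trace0 trace_ge0 trace_sigma_additive.

Let trace_fin : fin_num_fun trace_measure.
Proof.
move=> A /measurable_gE GA; apply: fin_num_measure.
by apply: measurableI => //; exact: Gm.
Qed.

HB.instance Definition _ := Measure_isFinite.Build _ _ _ trace_measure trace_fin.

Definition trace_finite : {finite_measure set (g_sigma_algebraType G) -> \bar R} :=
  trace_measure.

End TraceMeasure.

(** The conditional probability of [E] is the Radon-Nikodym density of the measure sending [A] in
    [G] to [P (A]&[E)], with respect to the restriction of [P]. *)
Lemma cond_prob_exists (E : set Om) : measurable E ->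
  exists f : g_sigma_algebraType G -> R, [/\ measurable_fun setT f,
    forall x, 0 <= f x &
    forall A, G A -> P (A `&` E) = (\int[sub_prob]_(x in A) (f x)%:E)%E].
Proof.
move=> mE; pose nuf := trace_finite mE.
have numu : nuf `<< sub_prob.
  apply/null_content_dominatesP => A /measurable_gE GA PA0.
  apply/eqP; rewrite eq_le measure_ge0 andbT -PA0 /=.
  by apply: le_measure; rewrite ?inE//; [apply: measurableI => //|]; exact: Gm.
have [f [f0 ffin fint fE]] := radon_nikodym_sigma_finite numu.
exists (fine \o f); split => //.
- by apply: measurableT_comp => //; exact: measurable_int fint.
- by move=> x /=; rewrite fine_ge0.
- move=> A GA; rewrite -[LHS]/(nuf A) fE; last exact/measurable_gE.
  by apply: eq_integral => x _; rewrite /= fineK.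
Qed.

End CondProb.

Lemma ae_forall_countable (d : measure_display) (T : measurableType d) (R : realType)
    (mu : {measure set T -> \bar R}) (I : countType) (Q : I -> T -> Prop) :
  (forall i, {ae mu, forall x, Q i x}) -> {ae mu, forall x, forall i, Q i x}.
Proof.
move=> h.
have : {ae mu, forall x, forall n : nat,
    match unpickle n with Some i => Q i x | None => True end}.
  by apply: ae_foralln => n; case: unpickle => [i|]; [exact: h|exact: aeW].
by apply: filterS => x /= H i; have := H (pickle i); rewrite pickleK.
Qed.

Section CondTail.
Context (R : realType) (dO : measure_display) (Om : measurableType dO).
Variables (P : probability Om R) (G : set (set Om)).
Hypotheses (sG : sigma_algebra setT G) (Gm : G `<=` measurable).
Variable (Y : Om -> R).
Hypotheses (mY : measurable_fun setT Y) (Y01 : forall om, 0 <= Y om <= 1).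

Local Notation gT := (g_sigma_algebraType G).
Local Notation PG := (sub_prob P sG Gm).

Lemma measurable_gt_preimage (r : R) : measurable [set om | r < Y om].
Proof.
rewrite (_ : mkset _ = setT `&` Y @^-1` `]r, +oo[); first exact: mY.
by rewrite setTI; apply/seteqP; split=> x /=; rewrite in_itv/= andbT.
Qed.

(** The conditional tails at rational levels, corrected on a null set so that bounds and
    monotonicity hold at every point. The quantile construction can then be carried out with no
    exceptional set. *)
Lemma cond_tail_exists : exists h : rat -> gT -> R,
  [/\ forall q, measurable_fun setT (h q), forall q x, 0 <= h q x <= 1,
      forall q q' x, q <= q' -> h q' x <= h q x,
      forall q x, 1 <= q -> h q x = 0 &
      forall q A, G A -> P (A `&` [set om | ratr q < Y om]) =
        (\int[PG]_(x in A) (h q x)%:E)%E].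
Proof.
have /choice[g gP] : forall q : rat, exists f : gT -> R,
    [/\ measurable_fun setT f, forall x, 0 <= f x & forall A, G A ->
      P (A `&` [set om | ratr q < Y om]) = (\int[PG]_(x in A) (f x)%:E)%E].
  by move=> q; apply: cond_prob_exists; exact: measurable_gt_preimage.
have mg q : measurable_fun setT (g q) by have [] := gP q.
have g0 q x : 0 <= g q x by have [] := gP q.
have gE q A : G A -> P (A `&` [set om | ratr q < Y om]) =
    (\int[PG]_(x in A) (g q x)%:E)%E by have [_ _] := gP q; exact.
have mE (q : rat) : measurable [set om | ratr q < Y om].
  exact: measurable_gt_preimage.
have gfin q : (\int[PG]_x (g q x)%:E < +oo)%E.
  rewrite -gE; last by apply/(measurable_gE sG); exact: measurableT.
  by rewrite -ge0_fin_numE// fin_num_measure// setTI.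
have g1 : {ae PG, forall x, forall q, g q x <= 1}.
  apply: ae_forall_countable => q; apply: le_ae_of_integral => //.
    by rewrite integral_cst// mul1e -ge0_fin_numE// fin_num_measure.
  move=> A mA; rewrite integral_cst// mul1e -gE; last exact/(measurable_gE sG).
  have mA' : measurable (A : set Om) by apply/Gm/(measurable_gE sG).
  by apply: le_measure; rewrite ?inE//; exact: measurableI.
have gmono : {ae PG, forall x, forall qq : rat * rat,
    qq.1 <= qq.2 -> g qq.2 x <= g qq.1 x}.
  apply: ae_forall_countable => -[q q'] /=.
  have [qq|] := boolP (q <= q'); last by move=> _; apply: aeW.
  have : {ae PG, forall x, g q' x <= g q x}.
    apply: le_ae_of_integral => // A mA; rewrite -!gE; try exact/(measurable_gE sG).
    have mA' : measurable (A : set Om) by apply/Gm/(measurable_gE sG).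
    apply: le_measure; rewrite ?inE; [exact: measurableI|exact: measurableI|].
    move=> om [Aom /= h]; split => //=; apply: le_lt_trans h; by rewrite ler_rat.
  by apply: filterS => x h _.
have [N [mN N0 NE]] : {ae PG, forall x, (forall q, g q x <= 1) /\
    forall qq : rat * rat, qq.1 <= qq.2 -> g qq.2 x <= g qq.1 x}.
  by move: g1 gmono; apply: filterS2 => x ? ?; split.
have NP x : ~ N x -> (forall q, g q x <= 1) /\
    forall qq : rat * rat, qq.1 <= qq.2 -> g qq.2 x <= g qq.1 x.
  by move=> Nx; apply: contrapT => /NE.
(* Off the [G]-measurable null set [N] all the countably many inequalities hold; on [N] the tail is
   reset to 0. From level 1 on it is 0 because [Y] is at most 1. *)
exists (fun q x => if q < 1 then g q x * \1_(~` N) x else 0); split.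
- move=> q; case: (q < 1) => //; apply: measurable_funM => //.
  by apply: measurable_indic; exact: measurableC.
- move=> q x; case: ifP => _; last by rewrite lexx ler01.
  rewrite indicE; case: (boolP (x \in _)) => xN; rewrite ?mulr1 ?mulr0 ?lexx ?ler01//.
  by rewrite g0; apply: (NP _ _).1; rewrite inE in xN.
- move=> q q' x qq; case: (ltP q' 1) => [q'1|_]; last first.
    by case: ifP => // _; rewrite mulr_ge0.
  rewrite (le_lt_trans qq q'1) indicE.
  case: (boolP (x \in _)) => xN; rewrite ?mulr1 ?mulr0//.
  by rewrite inE in xN; exact: (NP _ xN).2 (q, q') qq.
- by move=> q x q1; rewrite ltNge q1.
- move=> q A GA; case: (ltP q 1) => [_|q1].
    rewrite gE//; apply: ae_eq_integral => //; try exact/(measurable_gE sG).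
    + by apply: measurable_funTS; exact/measurable_EFinP.
    + apply: measurable_funTS; apply/measurable_EFinP; apply: measurable_funM => //.
      by apply: measurable_indic; exact: measurableC.
    + exists N; split => // x /= h; apply: contrapT => Nx; apply: h => _.
      by rewrite indicE mem_set// mulr1.
  rewrite integral0 (_ : _ `&` _ = set0) ?measure0//.
  apply/seteqP; split=> // om [_ /=]; apply/negP; rewrite -leNgt.
  have /andP[_ Y1] := Y01 om; apply: le_trans Y1 _.
  by rewrite [leLHS](_ : 1 = ratr 1) ?ler_rat// rmorph1.
Qed.

End CondTail.

Lemma uniform_prob_co (R : realType) (a : R) : 0 <= a <= 1 ->
  uniform_prob (@ltr01 R) [set u | 0 <= u < a] = a%:E.
Proof.
move=> /andP[a0 a1]; rewrite /uniform_prob.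
rewrite (eq_integral (fun=> 1%:E)); last first.
  move=> u; rewrite inE/= => /andP[u0 ua]; rewrite /uniform_pdf u0/=.
  by rewrite (ltW (lt_le_trans ua a1)) subr0 invr1.
rewrite (_ : mkset _ = `[0, a[%classic); last first.
  by apply/seteqP; split=> u /=; rewrite in_itv.
rewrite integral_cst//= mul1e lebesgue_measure_itv/= lte_fin.
case: ltP => [_|a0']; first by rewrite oppr0 adde0.
by congr (_%:E); apply/eqP; rewrite eq_le a0.
Qed.

(** Endpoints are rational because the conditional tails are available at rational levels only. *)
Definition rat_rays (R : realType) : set (set R) :=
  [set B | exists r : rat, B = `]ratr r, +oo[%classic].
Arguments rat_rays : clear implicits.

Lemma measurable_rat_rays (R : realType) :
  (measurable : set (set R)) = <<s rat_rays R >>.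
Proof.
rewrite [LHS]RGenOInfty.measurableE; apply/seteqP; split.
  apply: smallest_sub; first exact: smallest_sigma_algebra.
  move=> _ [x ->].
  rewrite (_ : `]x, +oo[%classic =
      \bigcup_(q in [set q : rat | x < ratr q]) `]ratr q, +oo[%classic).
    rewrite bigcup_mkcond.
    apply: (@countable_bigcupT_measurable _ (g_sigma_algebraType (rat_rays R))).
      exact: countableP.
    move=> q; case: ifPn => // _; apply: sub_sigma_algebra; by exists q.
  apply/seteqP; split => y /=; rewrite in_itv/= andbT.
    move=> /rat_in_itvoo[q]; rewrite in_itv/= => /andP[xq qy].
    by exists q => //=; rewrite in_itv/= qy.
  by move=> [q /= xq]; rewrite in_itv/= andbT; exact: lt_trans.
apply: smallest_sub; first exact: smallest_sigma_algebra.
by move=> _ [r ->]; apply: sub_sigma_algebra; exists (ratr r).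
Qed.

Lemma setI_rat_rays (R : realType) : setI_closed (rat_rays R).
Proof.
move=> _ _ [r ->] [s ->]; exists (Num.max r s).
apply/seteqP; split => y /=; rewrite !in_itv/= !andbT.
  by move=> [ry sy]; case: (leP r s).
case: (leP r s) => [rs|sr] h; split => //; apply: le_lt_trans h.
  by rewrite ler_rat.
by rewrite ler_rat ltW.
Qed.

Section CondQuantile.
Context (R : realType) (dO : measure_display) (Om : measurableType dO).
Variables (P : probability Om R) (G : set (set Om)).
Hypotheses (sG : sigma_algebra setT G) (Gm : G `<=` measurable).
Variable (Y : Om -> R).
Hypotheses (mY : measurable_fun setT Y) (Y01 : forall om, 0 <= Y om <= 1).

Local Notation gT := (g_sigma_algebraType G).
Local Notation PG := (sub_prob P sG Gm).
Local Notation lam := (uniform_prob (@ltr01 R)).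

Variable h : rat -> gT -> R.
Hypothesis mh : forall q, measurable_fun setT (h q).
Hypothesis h01 : forall q x, 0 <= h q x <= 1.
Hypothesis hmono : forall q q' x, q <= q' -> h q' x <= h q x.
Hypothesis h1 : forall q x, 1 <= q -> h q x = 0.
Hypothesis hE : forall q A, G A -> P (A `&` [set om | ratr q < Y om]) =
  (\int[PG]_(x in A) (h q x)%:E)%E.

(* The uniform variable u is sent to the generalized inverse of the conditional
   tail q |-> h q, so that the conditional law of Y is the law of u |-> Q(., u). *)
Definition quantile_set (p : gT * R) : set R :=
  [set x | x = 0 \/ exists2 q, x = ratr q & 0 <= p.2 < h q p.1].

Definition quantile (p : gT * R) : R := sup (quantile_set p).

Lemma has_sup_quantile p : has_sup (quantile_set p).
Proof.
split; first by exists 0; left.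
exists 1 => _ [->|[q -> /andP[u0 uh]]]; first exact: ler01.
rewrite leNgt; apply/negP => q1.
have : 1 <= q by rewrite -(ler_rat R) rmorph1 ltW.
by move=> /(h1 p.1) h0; rewrite h0 ltNge u0 in uh.
Qed.

Lemma quantile_ge0 p : 0 <= quantile p.
Proof. by apply: ub_le_sup; [exact: (has_sup_quantile p).2|left]. Qed.

(** No continuity in the level is imposed on [h], so a superlevel set of the quantile is a union
    over the rational levels above [r]. This union is countable, which also gives measurability. *)
Lemma lt_quantile r p : 0 <= r ->
  r < quantile p <-> exists2 q, r < ratr q & 0 <= p.2 < h q p.1.
Proof.
move=> r0; split.
  move=> /(sup_gt (has_sup_quantile p).1)[_ [->|[q -> hq]] rq].
    by rewrite ltNge r0 in rq.
  by exists q.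
move=> [q rq hq]; apply: lt_le_trans rq _; apply: ub_le_sup.
  exact: (has_sup_quantile p).2.
by right; exists q.
Qed.

Lemma measurable_lt_tail q : measurable [set p : gT * R | 0 <= p.2 < h q p.1].
Proof.
rewrite (_ : mkset _ = ((snd : gT * R -> R) @^-1` `[0, +oo[) `&`
   ((fun p : gT * R => h q p.1 - p.2) @^-1` `]0, +oo[)).
  apply: measurableI; rewrite -[X in measurable X]setTI.
    exact: measurable_snd.
  have : measurable_fun setT (fun p : gT * R => h q p.1 - p.2).
    apply: measurable_funB => //; apply: measurableT_comp => //.
  by apply.
by apply/seteqP; split => p /=; rewrite !in_itv/= !andbT subr_gt0 => /andP.
Qed.

Lemma measurable_quantile : measurable_fun setT quantile.
Proof.
apply: (measurability _ (RGenOInfty.measurableE R)).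
move=> _ [_ [r ->] <-]; rewrite setTI; have [r0|r0] := leP 0 r; last first.
  rewrite (_ : _ @^-1` _ = setT); first exact: measurableT.
  apply/seteqP; split=> // p _ /=; rewrite in_itv/= andbT.
  exact: lt_le_trans (quantile_ge0 p).
rewrite (_ : _ @^-1` _ = \bigcup_(q in [set q | r < ratr q])
    [set p : gT * R | 0 <= p.2 < h q p.1]).
  rewrite bigcup_mkcond; apply: countable_bigcupT_measurable => [|q].
    exact: countableP.
  by case: ifPn => // _; exact: measurable_lt_tail.
apply/seteqP; split=> p /=; rewrite in_itv/= andbT.
  by move=> /(lt_quantile _ r0)[q ? ?]; exists q.
by move=> [q /= ? ?]; apply/(lt_quantile _ r0); exists q.
Qed.

(** Both events are increasing unions along the levels [r + m.+1%:R^-1]. At each level the section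
    over a point [x] of [A] is the interval from 0 to [h (q m) x], so the product measure is the
    integral of the conditional tail; continuity from below concludes. *)
Lemma tail_quantile (A : set Om) (r : rat) : G A -> 0 <= r ->
  (PG \x lam)%E ((A : set gT) `*` setT `&` [set p | ratr r < quantile p]) =
  P (A `&` [set om | ratr r < Y om]).
Proof.
move=> GA r0; pose q m : rat := r + m.+1%:R^-1.
have r0' : 0 <= ratr r :> R by rewrite ler0q.
have qdec m n : (m <= n)%N -> q n <= q m.
  by move=> mn; rewrite lerD2l lef_pV2 ?posrE// ler_nat.
have qr m : ratr r < ratr (q m) :> R by rewrite ltr_rat ltrDl invr_gt0.
have qsmall (x : R) : ratr r < x -> exists m, ratr (q m) < x.
  move=> /ltr_add_invr[m hm]; exists m; rewrite rmorphD/= fmorphV/= ratr_nat//.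
have mA : measurable (A : set gT) by exact/(measurable_gE sG).
pose B m := (A : set gT) `*` setT `&` [set p : gT * R | 0 <= p.2 < h (q m) p.1].
have mB m : measurable (B m).
  by apply: measurableI; [exact: measurableX|exact: measurable_lt_tail].
have BE : (A : set gT) `*` setT `&` [set p | ratr r < quantile p] = \bigcup_m B m.
  apply/seteqP; split=> p; last first.
    by move=> [m _ [Ap /= hp]]; split => //=; apply/(lt_quantile _ r0'); exists (q m).
  move=> [Ap /= /(lt_quantile _ r0')[s rs /andP[u0 us]]].
  have [m hm] := qsmall _ rs; exists m => //; split => //=.
  by rewrite u0 (lt_le_trans us)// hmono// ltW// -(ltr_rat R).
have PBE m : (PG \x lam)%E (B m) = P (A `&` [set om | ratr (q m) < Y om]).
  rewrite hE// /product_measure1 [RHS]integral_mkcond; apply: eq_integral => x _ /=.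
  rewrite patchE; case: ifPn => xA.
    rewrite -(uniform_prob_co (h01 (q m) x)); congr (lam _).
    apply/seteqP; split => u; rewrite /xsection/= inE/=.
      by move=> [].
    by move=> ?; split => //; rewrite inE in xA; split.
  rewrite (_ : xsection _ _ = set0) ?measure0//.
  apply/seteqP; split => u //; rewrite /xsection/= inE/= => -[[/= Ax _] _].
  by rewrite notin_setE in xA.
have c1 : (PG \x lam)%E \o B @ \oo --> (PG \x lam)%E (\bigcup_m B m).
  apply: nondecreasing_cvg_mu => //; first exact: bigcupT_measurable.
  move=> m n mn; apply/subsetPset => p [Ap /= /andP[u0 uh]]; split => //=.
  by rewrite u0 (lt_le_trans uh)// hmono// qdec.
pose E m := A `&` [set om | ratr (q m) < Y om].
have mE m : measurable (E m).
  by apply: measurableI; [exact: Gm|exact: measurable_gt_preimage].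
have EE : A `&` [set om | ratr r < Y om] = \bigcup_m E m.
  apply/seteqP; split=> [om [Aom /= /qsmall[m hm]]|om [m _ [Aom /= hm]]].
    by exists m.
  by split => //=; exact: lt_trans hm.
have c2 : P \o E @ \oo --> P (\bigcup_m E m).
  apply: nondecreasing_cvg_mu => //; first exact: bigcupT_measurable.
  move=> m n mn; apply/subsetPset => om [Aom /= hm]; split => //=.
  by apply: le_lt_trans hm; rewrite ler_rat qdec.
have BEf : (PG \x lam)%E \o B = P \o E by apply/funext => m /=; exact: PBE.
by rewrite BEf in c1; rewrite BE EE; exact: (cvg_unique _ c1 c2).
Qed.

(** For fixed [A] both sides are finite measures in [C], so agreement on the intersection-stable
    class of rational rays suffices. For a negative endpoint both preimages are everything, as [Y]
    and the quantile are nonnegative. *)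
Lemma quantile_law (A : set Om) (C : set R) : G A -> measurable C ->
  P (A `&` Y @^-1` C) =
  (PG \x lam)%E ((A : set gT) `*` setT `&` quantile @^-1` C).
Proof.
move=> GA; have mA : measurable A by exact: Gm.
have mAg : measurable (A : set gT) by exact/(measurable_gE sG).
have mAT : measurable ((A : set gT) `*` setT : set (gT * R)) by exact: measurableX.
pose m1 := measure_function_pushforward__canonical__measure_function_Measure
  (mrestr P mA) mY.
pose m2 := measure_function_pushforward__canonical__measure_function_Measure
  (mrestr (PG \x lam)%E mAT) measurable_quantile.
suff : forall C, measurable C -> m1 C = m2 C.
  move=> m12 mC; have := m12 C mC; rewrite /m1 /m2 /= /pushforward /mrestr.
  by rewrite setIC (setIC (_ @^-1` C)).
apply: (@measure_unique _ _ _ (rat_rays R) (fun k => `]ratr (- k%:R), +oo[%classic)).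
- exact: measurable_rat_rays.
- exact: setI_rat_rays.
- by move=> k; exists (- k%:R).
- apply/seteqP; split=> // x _; exists (Num.bound `|x|) => //=.
  rewrite in_itv/= andbT rmorphN/= ratr_nat ltrNl.
  by rewrite (le_lt_trans _ (archi_boundP (normr_ge0 x)))// -normrN ler_norm.
- move=> _ [r ->]; rewrite /m1 /m2 /= /pushforward /mrestr/=.
  rewrite setIC [in RHS]setIC.
  have YE : Y @^-1` `]ratr r, +oo[ = [set om | ratr r < Y om].
    by apply/seteqP; split=> x /=; rewrite in_itv/= andbT.
  have QE : quantile @^-1` `]ratr r, +oo[ = [set p | ratr r < quantile p].
    by apply/seteqP; split=> x /=; rewrite in_itv/= andbT.
  have [r0|r0] := leP 0 r; first by rewrite YE QE tail_quantile.
  have r0' : ratr r < 0 :> R by rewrite ltrq0.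
  rewrite YE QE (_ : mkset _ = setT); last first.
    apply/seteqP; split=> // om _ /=; apply: lt_le_trans r0' _.
    by have /andP[] := Y01 om.
  rewrite (_ : [set p | _] = setT); last first.
    by apply/seteqP; split=> // p _ /=; exact: lt_le_trans (quantile_ge0 p).
  rewrite !setIT; transitivity (PG A * lam setT)%E.
    by rewrite [X in (_ * X)%E]probability_setT mule1.
  by rewrite -product_measure1E.
- move=> k; rewrite /m1 /= /pushforward /mrestr.
  apply: le_lt_trans (ltry 1); rewrite -(@probability_setT _ _ _ P).
  apply: le_measure; rewrite ?inE//; apply: measurableI => //.
  by rewrite -[X in measurable X]setTI; exact: mY.
Qed.

End CondQuantile.

(** * Ternary codes of bit sequences and of vectors *)

Section TernaryCode.
Context (R : realType).

(** The contribution [2 * 3^-1 ^+ k.+1] of a ternary digit 2. Leaving out the digit 1 makes the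
    expansion unique, which fails for binary digits. *)
Definition tern_term (b : nat -> bool) (k : nat) : R :=
  (b k)%:R * geometric (2 / 3) 3^-1 k.

Definition tern_code (b : nat -> bool) : R := limn (series (tern_term b)).

Lemma geometric23_ge0 k : 0 <= geometric (2 / 3) 3^-1 k :> R.
Proof. by rewrite /geometric/= mulr_ge0 ?exprn_ge0 ?divr_ge0 ?invr_ge0. Qed.

Lemma tern_term_ge0 b k : 0 <= tern_term b k.
Proof. by rewrite mulr_ge0 ?ler0n ?geometric23_ge0. Qed.

Lemma tern_term_le b k : tern_term b k <= geometric (2 / 3) 3^-1 k.
Proof. by rewrite ler_piMl ?geometric23_ge0//; case: (b k). Qed.

Lemma third_lt1 : `|3^-1 : R| < 1.
Proof. by rewrite gtr0_norm; lra. Qed.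

Lemma tern_cvg b : series (tern_term b) @ \oo --> tern_code b.
Proof.
apply: (@series_le_cvg _ _ (geometric (2 / 3) 3^-1)).
- exact: tern_term_ge0.
- exact: geometric23_ge0.
- exact: tern_term_le.
- exact: is_cvg_geometric_series third_lt1.
Qed.

Lemma tern_code_ge0 b : 0 <= tern_code b.
Proof.
apply: limr_ge; first exact: tern_cvg.
by apply: nearW => n; rewrite /series/= sumr_ge0// => k _; exact: tern_term_ge0.
Qed.

Lemma tern_code_le1 b : tern_code b <= 1.
Proof.
have -> : 1 = (2 / 3) / (1 - 3^-1) :> R by field.
rewrite -(cvg_lim (@Rhausdorff R) (cvg_geometric_series (a := 2 / 3) third_lt1)).
apply: ler_lim.
- exact: tern_cvg.
- exact: is_cvg_geometric_series third_lt1.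
- by apply: nearW => n; apply: ler_sum => k _; exact: tern_term_le.
Qed.

Lemma tern_codeS b : tern_code b = (b 0%N)%:R * (2 / 3) + tern_code (b \o S) / 3.
Proof.
have h : series (tern_term b) \o S @ \oo -->
    (b 0%N)%:R * (2 / 3) + tern_code (b \o S) / 3.
  rewrite (_ : _ \o S =
      (fun n => (b 0%N)%:R * (2 / 3) + series (tern_term (b \o S)) n / 3)).
    apply: cvgD; first exact: cvg_cst.
    by apply: cvgMl; exact: tern_cvg.
  apply/funext => n /=; rewrite /series/= big_nat_recl//= {1}/tern_term /geometric/=.
  rewrite expr0 mulr1 mulr_suml; congr (_ + _); apply: eq_bigr => k _.
  rewrite /tern_term /geometric/= exprS; ring.
have := @tern_cvg b; rewrite -cvg_shiftS => h'.
exact: (cvg_unique (@Rhausdorff R) h' h).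
Qed.

(** The iterated Cantor map: tripling and subtracting the leading digit shifts the expansion by one
    place. *)
Fixpoint tern_tail (k : nat) (y : R) : R :=
  if k is k'.+1 then let z := tern_tail k' y in 3 * z - 2 * (2^-1 <= z)%R%:R else y.

Definition tern_bit (k : nat) (y : R) : bool := 2^-1 <= tern_tail k y.

(** A leading digit 2 puts the code in [[2/3, 1]], a leading digit 0 in [[0, 1/3]]; the threshold
    one half separates the two. *)
Lemma tern_bit0 b : (2^-1 <= tern_code b) = b 0%N.
Proof.
rewrite tern_codeS; have := tern_code_ge0 (b \o S); have := tern_code_le1 (b \o S).
by case: (b 0%N) => /= h1 h0; apply/idP; [|apply/negP; rewrite -ltNge]; lra.
Qed.

Lemma tern_tail_code k b : tern_tail k (tern_code b) = tern_code (fun n => b (n + k)%N).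
Proof.
elim: k => [|k IH] /=; first by congr tern_code; apply/funext => n; rewrite addn0.
rewrite IH tern_bit0 [in LHS]tern_codeS/=.
rewrite (_ : _ \o S = fun n => b (n + k.+1)%N).
  by case: (b _) => /=; field.
by apply/funext => n /=; rewrite addnS addSn.
Qed.

Lemma tern_bitK k b : tern_bit k (tern_code b) = b k.
Proof. by rewrite /tern_bit tern_tail_code tern_bit0. Qed.

Lemma measurable_tern_tail k : measurable_fun setT (tern_tail k).
Proof.
elim: k => [|k IH] /=; first exact: measurable_id.
apply: measurable_funB; first by apply: measurable_funM.
apply: measurable_funM => //.
rewrite (_ : (fun _ => _) = \1_(tern_tail k @^-1` `[2^-1, +oo[)).
  apply: measurable_indic; rewrite -[X in measurable X]setTI; exact: IH.
apply/funext => y; rewrite indicE; congr (_%:R); congr nat_of_bool.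
by apply/idP/idP; rewrite inE /= in_itv/= andbT.
Qed.

Lemma measurable_tern_bit k : measurable [set y | tern_bit k y].
Proof.
rewrite (_ : mkset _ = setT `&` tern_tail k @^-1` `[2^-1, +oo[).
  exact: measurable_tern_tail.
by apply/seteqP; split => y; rewrite setTI/= in_itv/= andbT.
Qed.

Lemma measurable_tern_code (d : measure_display) (T : measurableType d)
    (b : nat -> T -> bool) : (forall k, measurable [set x | b k x]) ->
  measurable_fun setT (fun x => tern_code (b ^~ x)).
Proof.
move=> mb; apply: (@measurable_fun_cvg _ _ _ setT
  (fun n x => series (tern_term (b ^~ x)) n)); last by move=> x _; exact: tern_cvg.
move=> n; rewrite /series/=; apply: measurable_sum => k.
apply: measurable_funM => //.
rewrite (_ : (fun _ => _) = \1_[set x | b k x]).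
  exact: measurable_indic.
apply/funext => y; rewrite indicE; congr (_%:R); congr nat_of_bool.
by apply/idP/idP; rewrite inE.
Qed.

End TernaryCode.

Section VectorCode.
Context (R : realType) (d : nat).

(* The ternary digits 0 and 2 of the code record the truth values of q < x_i for q
   rational: a Borel injection into [0, 1] with a Borel left inverse, which reduces
   conditional laws on R^d to conditional laws on the line. *)
Definition row_bit (k : nat) (x : 'rV[R]_d) : bool :=
  if unpickle k is Some (i, q) then ratr (q : rat) < x 0 (i : 'I_d) else false.

Definition row_code (x : 'rV[R]_d) : R := tern_code R (row_bit ^~ x).

(** The supremum is extended real since for [y] that is not a code the set of rationals may be empty
    or unbounded; on the code of [x] it recovers coordinate [i] as the supremum of the rationals
    below it. *)
Definition coord_decode (i : 'I_d) (y : R) : \bar R :=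
  ereal_sup [set (ratr q)%:E | q in [set q : rat | tern_bit (pickle (i, q)) y]].

Definition row_decode (y : R) : 'rV[R]_d := \row_i fine (coord_decode i y).

Lemma row_codeK : cancel row_code row_decode.
Proof.
move=> x; apply/rowP => i; rewrite mxE /coord_decode.
rewrite [X in fine X](_ : _ = (x 0 i)%:E)//.
have bE q : tern_bit (pickle (i, q)) (row_code x) = (ratr q < x 0 i).
  by rewrite tern_bitK /row_bit pickleK.
apply/eqP; rewrite eq_le; apply/andP; split.
  by apply: ge_ereal_sup => _ [q /= + <-]; rewrite bE lee_fin => /ltW.
set s := ereal_sup _; have sub q : ratr q < x 0 i -> ((ratr q)%:E <= s)%E.
  by move=> qx; apply: ereal_sup_ubound; exists q => //=; rewrite bE.
rewrite leNgt; apply/negP => h.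
have [q] : exists q : rat, (s < (ratr q)%:E)%E /\ ratr q < x 0 i.
  move: h; case: (s) => [t| |]//; rewrite ?lte_fin.
    by move=> /rat_in_itvoo[q]; rewrite in_itv/= => /andP[? ?]; exists q; rewrite lte_fin.
  have /rat_in_itvoo[q] : x 0 i - 1 < x 0 i by rewrite ltrBlDr ltrDl.
  by rewrite in_itv/= => /andP[_ ?] _; exists q; rewrite ltNyr.
by move=> [+ qx]; apply/negP; rewrite -leNgt; exact: sub.
Qed.

Lemma measurable_row_code (dT : measure_display) (T : measurableType dT)
    (X : T -> 'rV[R]_d) : (forall i, measurable_fun setT (fun x => X x 0 i)) ->
  measurable_fun setT (row_code \o X).
Proof.
move=> mX; apply: measurable_tern_code => k; rewrite /row_bit.
case: unpickle => [[i q]|]; last first.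
  by rewrite (_ : mkset _ = set0)//; apply/seteqP; split.
rewrite (_ : mkset _ = setT `&` (fun x => X x 0 i) @^-1` `]ratr q, +oo[).
  exact: mX.
by rewrite setTI; apply/seteqP; split => y /=; rewrite in_itv/= andbT.
Qed.

Lemma measurable_row_decode : measurable_fun setT (row_decode : R -> BorelRd R d).
Proof.
apply/measurable_rowP => i.
rewrite (_ : (fun x => _) = fine \o coord_decode i); last first.
  by apply/funext => y; rewrite mxE.
apply: measurableT_comp => //.
apply: (measurability _ (ErealGenOInfty.measurableE R)).
move=> _ [_ [r ->] <-]; rewrite setTI.
rewrite (_ : _ @^-1` _ = \bigcup_(q in [set q : rat | r < ratr q])
    [set y | tern_bit (pickle (i, q)) y]).
  rewrite bigcup_mkcond; apply: countable_bigcupT_measurable => [|q].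
    exact: countableP.
  by case: ifPn => // _; exact: measurable_tern_bit.
apply/seteqP; split=> y /=; rewrite in_itv/= andbT.
  by move=> /ereal_sup_gt[_ [q /= hq <-]]; rewrite lte_fin => rq; exists q.
move=> [q /= rq hq]; apply: (@lt_le_trans _ _ (ratr q)%:E); first by rewrite lte_fin.
by apply: ereal_sup_ubound; exists q.
Qed.

End VectorCode.

(** The kernel at [om] is the law of the decoded quantile at [(om, u)] for [u] uniform. As decoding
    inverts coding, an event on [X] is an event on the code [Y], to which [quantile_law] applies. *)
Lemma is_rcd_exists (R : realType) (d : nat) (dO : measure_display)
    (Om : measurableType dO) (P : probability Om R) (G : set (set Om))
    (X : Om -> 'rV[R]_d) :
  sigma_algebra setT G -> G `<=` measurable ->
  (forall i, measurable_fun setT (fun om => X om 0 i)) ->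
  exists K, is_rcd P G X K.
Proof.
move=> sG Gm mX; pose Y := row_code (d := d) \o X.
have mY : measurable_fun setT Y by exact: measurable_row_code.
have Y01 om : 0 <= Y om <= 1 by rewrite tern_code_ge0 tern_code_le1.
have [h [mh h01 hmono h1 hE]] := cond_tail_exists P sG Gm mY Y01.
have mQ := measurable_quantile mh h1.
have mZ om : @measurable_fun _ _ (measurableTypeR R) (BorelRd R d) setT
    (fun u => row_decode d (quantile h (om, u))).
  apply: (measurableT_comp (@measurable_row_decode R d)).
  exact: (measurableT_comp mQ (pair1_measurable om)).
pose Z om : {mfun measurableTypeR R >-> BorelRd R d} :=
  HB.pack (fun u => row_decode d (quantile h (om, u)) : BorelRd R d)
    (isMeasurableFun.Build _ _ _ _ _ (mZ om)).
pose lam := uniform_prob (@ltr01 R).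
pose K om : probability (BorelRd R d) R := distribution lam (Z om).
have mW (B : set (BorelRd R d)) : measurable B ->
    measurable [set p : g_sigma_algebraType G * R | B (row_decode d (quantile h p))].
  move=> mB; rewrite -[X in measurable X]setTI.
  by have := measurableT_comp (@measurable_row_decode R d) mQ; apply.
have KE (B : set (BorelRd R d)) om : K om B = lam (xsection
    [set p : g_sigma_algebraType G * R | B (row_decode d (quantile h p))] om).
  rewrite /K /distribution /pushforward; congr (lam _).
  by apply/seteqP; split => u /=; rewrite /xsection/= inE.
have mK (B : set (BorelRd R d)) : measurable B ->
    measurable_fun setT ((fun om => K om B) : g_sigma_algebraType G -> \bar R).
  move=> mB; under eq_fun do rewrite KE.
  exact: (measurable_fun_xsection lam (mW B mB)).
exists K; split=> [B mB|A B GA mB].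
  by apply/(meas_wrtP _ sG); apply: measurableT_comp => //; exact: mK.
rewrite -(integral_sub_prob P sG Gm)//; last exact: mK.
have -> : A `&` (X : Om -> BorelRd R d) @^-1` B =
    A `&` Y @^-1` ((row_decode d : R -> BorelRd R d) @^-1` B).
  by apply/seteqP; split => om [Aom] /=; rewrite /Y /= row_codeK.
rewrite (quantile_law mY Y01 mh h01 hmono h1 hE)//; last first.
  by rewrite -[X in measurable X]setTI; exact: measurable_row_decode.
rewrite /product_measure1 [RHS]integral_mkcond; apply: eq_integral => om _.
rewrite patchE KE /comp; case: ifPn => omA.
  congr (lam _); apply/seteqP; split => u; rewrite /xsection/= !inE/=.
    by move=> [].
  by move=> ?; split => //; rewrite inE in omA; split.
rewrite (_ : xsection _ _ = set0) ?measure0//.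
apply/seteqP; split => u //; rewrite /xsection/= inE/= => -[[/= Ax _] _].
by rewrite notin_setE in omA.
Qed.

(** * Conditional supports and orthogonality *)

Section Inner.
Context (R : realType) (d : nat).
Implicit Types v x y : 'rV[R]_d.

Lemma innerDr v x y : inner v (x + y) = inner v x + inner v y.
Proof.
by rewrite /inner -big_split; apply: eq_bigr => i _; rewrite mxE mulrDr.
Qed.

Lemma innerZr v (l : R) x : inner v (l *: x) = l * inner v x.
Proof.
by rewrite /inner mulr_sumr; apply: eq_bigr => i _; rewrite mxE mulrCA.
Qed.

Lemma innerC v x : inner v x = inner x v.
Proof. by apply: eq_bigr => i _; rewrite mulrC. Qed.

Lemma innerDl v x y : inner (x + y) v = inner x v + inner y v.
Proof. by rewrite !(innerC _ v) innerDr. Qed.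

Lemma innerZl v (l : R) x : inner (l *: x) v = l * inner x v.
Proof. by rewrite !(innerC _ v) innerZr. Qed.

Lemma innerNl v x : inner (- x) v = - inner x v.
Proof. by rewrite -scaleN1r innerZl mulN1r. Qed.

Lemma inner0l v : inner 0 v = 0.
Proof. by rewrite /inner big1// => i _; rewrite mxE mul0r. Qed.

Lemma inner_self_eq0 v : inner v v = 0 -> v = 0.
Proof.
move=> /eqP; rewrite psumr_eq0; last by move=> i _; rewrite -expr2 sqr_ge0.
move=> /allP h; apply/rowP => i; rewrite mxE.
by have := h i (mem_index_enum i); rewrite -expr2 sqrf_eq0 => /eqP.
Qed.

Lemma affine_inner_eq0 v : affine_set [set x | inner v x = 0].
Proof.
by move=> x y l /= vx vy; rewrite innerDr !innerZr vx vy !mulr0 addr0.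
Qed.

Definition rat_center (qn : 'rV[rat]_d * nat) : 'rV[R]_d := map_mx ratr qn.1.

(** A certificate that [inner v] vanishes nowhere on the ball, since on it [inner v] deviates from
    its central value by at most the radius times the l1 norm of [v]. It turns the condition
    [inner v x != 0] into countably many conditions that treat [v] and [x] separately. *)
Definition far_ball v (qn : 'rV[rat]_d * nat) : bool :=
  qn.2.+1%:R^-1 * (\sum_i `|v 0 i|) < `|inner v (rat_center qn)|.

Lemma inner_rat_ball_dist v qn x : rat_ball qn x ->
  `|inner v (rat_center qn) - inner v x| <= qn.2.+1%:R^-1 * (\sum_i `|v 0 i|).
Proof.
move=> /rat_ballP xq; rewrite /inner -sumrB (le_trans (ler_norm_sum _ _ _))//.
rewrite mulr_sumr; apply: ler_sum => i _.
by rewrite -mulrBr normrM mulrC ler_wpM2r// mxE ltW.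
Qed.

Lemma far_ball_neq0 v qn x : far_ball v qn -> rat_ball qn x -> inner v x != 0.
Proof.
move=> far /(inner_rat_ball_dist v) xq; apply/eqP => vx0.
by move: xq far; rewrite vx0 subr0 leNgt /far_ball => /negP.
Qed.

Lemma far_ball_exists v x : inner v x != 0 ->
  exists2 qn, far_ball v qn & rat_ball qn x.
Proof.
move=> vx0; pose s := \sum_i `|v 0 i|.
have s0 : 0 <= s by apply: sumr_ge0.
(* For radius [e] the value at the center is at least [|inner v x| - e * s], and it has to exceed
   [e * s]. The denominator has [s + 1] so that it is plainly positive. *)
have a0 : 0 < `|inner v x| / (2 * (s + 1)).
  by rewrite divr_gt0 ?normr_gt0// mulr_gt0// ltr_wpDl.
have [n] := ltr_add_invr a0; rewrite add0r => na.
have [q qx] := rat_ball_around x n.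
exists (q, n) => //; have := inner_rat_ball_dist v qx.
rewrite /far_ball/= -/s; move: na; rewrite ltr_pdivlMr; last by rewrite mulr_gt0// ltr_wpDl.
have n0 : (0 : R) < n.+1%:R^-1 by rewrite invr_gt0.
move: n0; move: (n.+1%:R^-1) => e e0 h1 h2.
have : `|inner v x| <= `|inner v (rat_center (q, n))| + e * s.
  have := ler_normD (inner v x - inner v (rat_center (q, n))) (inner v (rat_center (q, n))).
  by rewrite subrK distrC; lra.
nra.
Qed.

(** Every point outside the support lies in a rational ball of measure 0, and there are countably
    many of these; hence the complement of the support is null. *)
Lemma support_null_ball (mu : probability (BorelRd R d) R) qn :
  rat_ball qn `&` Defs.support mu = set0 -> mu (rat_ball qn) = 0%E.
Proof.
move=> disj.
have mball q : measurable (rat_ball q : set (BorelRd R d)).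
  by apply: sub_sigma_algebra; exact: open_rat_ball.
have : {ae mu, forall x, forall q : 'rV[rat]_d * nat,
    mu (rat_ball q) = 0%E -> ~ rat_ball q x}.
  apply: ae_forall_countable => q.
  have [q0|] := pselect (mu (rat_ball q) = 0%E); last by move=> ?; apply: aeW.
  by exists (rat_ball q); split => // x /= h; apply: contrapT => ?; apply: h.
move=> [N [mN N0 NE]].
apply: (subset_measure0 (mball qn) mN) => // x xq; apply: NE => /= h.
have : ~ Defs.support mu x.
  by move=> sx; have : (rat_ball qn `&` Defs.support mu) x by []; rewrite disj.
move=> /existsNP[V /not_implyP[oV /not_implyP[Vx /negP]]].
rewrite -leNgt measure_le0 => /eqP V0.
have [q qx qV] := rat_ball_base oV Vx.
apply: (h q) => //; apply: (subset_measure0 (mball q) _ qV V0).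
exact: sub_sigma_algebra.
Qed.

End Inner.

Section Orthogonality.
Context (R : realType) (d : nat) (dO : measure_display) (Om : measurableType dO).
Variables (P : probability Om R) (G : set (set Om)).
Hypotheses (sG : sigma_algebra setT G) (Gm : G `<=` measurable).
Local Notation gT := (g_sigma_algebraType G).
Variable psi : Om -> 'rV[R]_d.
Hypothesis mpsi : forall i, measurable_fun setT ((fun om => psi om 0 i) : gT -> R).

Lemma rcd_null (X : Om -> 'rV[R]_d) K (A : set Om) (B : set (BorelRd R d)) :
  is_rcd P G X K -> G A -> measurable B ->
  P (A `&` (X : Om -> BorelRd R d) @^-1` B) = 0%E <->
  {ae P, forall om, A om -> K om B = 0%E}.
Proof.
move=> [mK KE] GA mB; rewrite KE//.
have mKB : measurable_fun setT (fun om => K om B).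
  rewrite (_ : (fun om => _) = EFin \o (fun om => fine (K om B))).
    apply/measurable_EFinP/(sub_measurable_fun sG Gm)/(meas_wrtP _ sG).
    exact: mK.
  by apply/funext => om /=; rewrite fineK// fin_num_measure.
rewrite (_ : (\int[P]_(om in A) K om B = \int[P]_(om in A) `|K om B|)%E); last first.
  by apply: eq_integral => om _; rewrite gee0_abs.
by rewrite ae_eq_integral_abs//; [exact: Gm|exact: measurable_funTS].
Qed.

Lemma measurable_far_ball qn : G [set om | far_ball (psi om) qn].
Proof.
apply/(measurable_gE sG).
rewrite (_ : mkset _ = setT `&` (fun om : gT => `|inner (psi om) (rat_center _ qn)| -
  qn.2.+1%:R^-1 * (\sum_i `|psi om 0 i|)) @^-1` `]0, +oo[).
  have : measurable_fun setT (fun om : gT => `|inner (psi om) (rat_center _ qn)| -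
      qn.2.+1%:R^-1 * (\sum_i `|psi om 0 i|)).
    apply: measurable_funB.
      apply: measurableT_comp => //; apply: measurable_sum => i.
      by apply: measurable_funM.
    apply: measurable_funM => //; apply: measurable_sum => i.
    exact: measurableT_comp.
  by apply.
by rewrite setTI; apply/seteqP; split => om /=; rewrite in_itv/= andbT subr_gt0.
Qed.

Let mball qn : measurable (rat_ball qn : set (BorelRd R d)).
Proof. by apply: sub_sigma_algebra; exact: open_rat_ball. Qed.

Lemma measurable_far_ballI (X : Om -> 'rV[R]_d) qn :
  measurable_fun setT (X : Om -> BorelRd R d) ->
  measurable ([set om | far_ball (psi om) qn] `&`
    (X : Om -> BorelRd R d) @^-1` rat_ball qn).
Proof.
move=> mX; apply: measurableI; first exact/Gm/measurable_far_ball.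
by rewrite -[X in measurable X]setTI; exact: mX.
Qed.

(** Where the pair of [psi] and a ball is far, [X] a.s. avoids the ball, so its conditional mass is
    0. A support point not orthogonal to [psi] would lie in such a ball, although open sets around
    support points have positive mass. *)
Lemma support_orth (X : Om -> 'rV[R]_d) K : is_rcd P G X K ->
  measurable_fun setT (X : Om -> BorelRd R d) ->
  {ae P, forall om, inner (psi om) (X om) = 0} ->
  {ae P, forall om, Defs.support (K om) `<=` [set x | inner (psi om) x = 0]}.
Proof.
move=> rK mX orth.
have : {ae P, forall om, forall qn, far_ball (psi om) qn -> K om (rat_ball qn) = 0%E}.
  apply: ae_forall_countable => qn; apply/(rcd_null rK) => //.
    exact: measurable_far_ball.
  move: orth => [N [mN N0 NE]].
  apply: (subset_measure0 (measurable_far_ballI qn mX) mN _ N0) => om [/= far xq].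
  by apply: NE => /= /eqP; apply/negP; exact: far_ball_neq0 far xq.
apply: filterS => om h x sx; apply/eqP; apply: contrapT => /negP.
move=> /far_ball_exists[qn far xq].
have := sx _ (@open_rat_ball R d qn) xq.
by rewrite (h _ far) ltxx.
Qed.

Lemma orth_of_support (X : Om -> 'rV[R]_d) K : is_rcd P G X K ->
  measurable_fun setT (X : Om -> BorelRd R d) ->
  {ae P, forall om, Defs.support (K om) `<=` [set x | inner (psi om) x = 0]} ->
  {ae P, forall om, inner (psi om) (X om) = 0}.
Proof.
move=> rK mX sup.
have : {ae P, forall om, forall qn, ~ (far_ball (psi om) qn /\ rat_ball qn (X om))}.
  apply: ae_forall_countable => qn.
  have : P ([set om | far_ball (psi om) qn] `&`
      (X : Om -> BorelRd R d) @^-1` rat_ball qn) = 0%E.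
    apply/(rcd_null rK) => //; first exact: measurable_far_ball.
    move: sup; apply: filterS => om sup /= far.
    apply: support_null_ball; apply/seteqP; split => // x [xq /sup/= h].
    by have := far_ball_neq0 far xq; rewrite h eqxx.
  move=> h; exists ([set om | far_ball (psi om) qn] `&`
      (X : Om -> BorelRd R d) @^-1` rat_ball qn).
  by split => //; [exact: measurable_far_ballI|move=> om /= /contrapT].
apply: filterS => om h; apply/eqP; apply: contrapT => /negP.
by move=> /far_ball_exists[qn far xq]; apply: (h qn).
Qed.

End Orthogonality.

(** The orthogonal complement of [psi] is an affine set: once it contains the support for [S'] it
    contains the affine hull, hence by inclusion the support for [S]. *)
Lemma orth_transfer (R : realType) (d : nat) (dO : measure_display)
    (Om : measurableType dO) (P : probability Om R) (F : nat -> set (set Om))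
    (S S' : nat -> Om -> 'rV[R]_d) (t : nat) (psi : Om -> 'rV[R]_d) :
  sigma_algebra setT (F t.-1) -> F t.-1 `<=` measurable ->
  measurable_fun setT (incr S t : Om -> BorelRd R d) ->
  measurable_fun setT (incr S' t : Om -> BorelRd R d) ->
  D_incl P F S S' t -> vec_meas (F t.-1) psi ->
  {ae P, forall om, inner (psi om) (incr S' t om) = 0} ->
  {ae P, forall om, inner (psi om) (incr S t om) = 0}.
Proof.
move=> sG Gm mS mS' DSS mpsi orth.
have [K rK] := is_rcd_exists P sG Gm ((measurable_rowP _).1 mS).
have [K' rK'] := is_rcd_exists P sG Gm ((measurable_rowP _).1 mS').
have mpsi' : forall i, measurable_fun setT
    ((fun om => psi om 0 i) : g_sigma_algebraType (F t.-1) -> R).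
  by apply/measurable_rowP; exact/(meas_wrtP _ sG).
apply: (orth_of_support sG Gm mpsi' rK mS).
have := support_orth sG Gm mpsi' rK' mS' orth.
have := DSS K K' rK rK'.
apply: filterS2 => om hull sup x sx.
apply: (hull x); first by move=> V _; exact.
  exact: affine_inner_eq0.
exact: sup.
Qed.

(** * One-period projection and boundedness *)

Lemma cvg_inner (R : realType) (d : nat) (u : nat -> 'rV[R]_d) (l x : 'rV[R]_d) :
  (forall i, (fun n => u n 0 i) @ \oo --> l 0 i) ->
  (fun n => inner (u n) x) @ \oo --> inner l x.
Proof.
move=> ul; rewrite /inner; apply: cvg_big => //=; first exact: add_continuous.
by move=> i _; apply: cvgMl; exact: ul.
Qed.

Lemma limn_einfE (R : realType) (u : nat -> \bar R) :
  limn_einf u = ereal_sup (range (einfs u)).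
Proof. by rewrite limn_einf_lim; apply/cvg_lim => //; exact: cvg_einfs_sup. Qed.

Lemma le_limn_einf (R : realType) (u : nat -> \bar R) (a : \bar R) :
  (forall c : R, (c%:E < a)%E -> \forall k \near \oo, (c%:E <= u k)%E) ->
  (a <= limn_einf u)%E.
Proof.
move=> h; rewrite limn_einfE leNgt; apply/negP => ltua.
have [c [uc ca]] : exists c : R,
    (ereal_sup (range (einfs u)) < c%:E)%E /\ (c%:E < a)%E.
  move: ltua; case: (ereal_sup _) => [s| |]//; case: a {h} => [a| |]//.
  - rewrite lte_fin => sa; exists ((s + a) / 2); rewrite !lte_fin; lra.
  - by move=> _; exists (s + 1); rewrite lte_fin ltrDl ltr01 ltry.
  - by move=> _; exists (a - 1); rewrite ltNyr lte_fin ltrBlDr ltrDl ltr01.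
  - by move=> _; exists 0; rewrite ltNyr ltry.
have [n _ hn] := h c ca.
move: uc; apply/negP; rewrite -leNgt; apply: le_trans (ereal_sup_ubound _); last first.
  by exists n.
by apply: le_ereal_inf_tmp => _ [k /= nk <-]; exact: hn.
Qed.

Lemma fatou_ae_le (R : realType) (d : measure_display) (T : measurableType d)
    (mu : {measure set T -> \bar R}) (f : nat -> T -> \bar R) (g : T -> \bar R)
    (b : nat -> R) (r : R) :
  (forall n, measurable_fun setT (f n)) -> measurable_fun setT g ->
  (forall n x, 0 <= f n x)%E -> (forall x, 0 <= g x)%E ->
  {ae mu, forall x, g x <= limn_einf (f ^~ x)}%E ->
  (forall n, \int[mu]_x f n x <= (b n)%:E)%E -> b @ \oo --> r ->
  (\int[mu]_x g x <= r%:E)%E.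
Proof.
move=> mf mg f0 g0 gf fb br.
have mlim : measurable_fun setT (fun x => limn_einf (f ^~ x)).
  rewrite /limn_einf; apply: measurableT_comp => //.
  by apply: measurable_fun_limn_esup => n; exact: measurableT_comp.
apply: (@le_trans _ _ (\int[mu]_x limn_einf (f ^~ x))%E).
  apply: ae_ge0_le_integral => //.
    move=> x _; apply: le_limn_einf => c c0; apply: nearW => k.
    exact: le_trans (ltW c0) (f0 _ _).
  by move: gf; apply: filterS.
apply: (le_trans (fatou mu measurableT mf (fun n x _ => f0 n x))).
rewrite limn_einfE; apply: ge_ereal_sup => _ [n _ <-].
have bE : (fun k => (b k)%:E) @ \oo --> r%:E by apply: cvg_EFin => //; exact: nearW.
rewrite -(cvg_lim _ bE)//; apply: lime_ge; first by apply/cvg_ex; exists r%:E.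
exists n => // k /= nk; apply: le_trans (fb k).
by apply: ereal_inf_lbound; exists k.
Qed.

Lemma measurable_invr (R : realType) : measurable_fun setT (@GRing.inv R).
Proof.
rewrite -(setUv [set 0]); apply/measurable_funU => //; first exact: measurableC.
split.
  apply: (@eq_measurable_fun _ _ R R [set 0] (fun=> 0)) => [x|].
    by rewrite inE => ->; rewrite invr0.
  exact: measurable_cst.
apply: open_continuous_measurable_fun.
  by apply: closed_openC; exact: closed_eq.
by move=> x; rewrite inE/= => /eqP x0; exact: inv_continuous.
Qed.

Section OnePeriod.
Context (R : realType) (d : nat) (dO : measure_display) (Om : measurableType dO).
Variables (P : probability Om R) (G : set (set Om)).
Hypotheses (sG : sigma_algebra setT G) (Gm : G `<=` measurable).
Local Notation gT := (g_sigma_algebraType G).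
Variable X : Om -> 'rV[R]_d.

Definition gmeas (f : Om -> 'rV[R]_d) : Prop :=
  forall i, measurable_fun setT ((fun om => f om 0 i) : gT -> R).

Definition nul (nu : Om -> 'rV[R]_d) : Prop :=
  gmeas nu /\ {ae P, forall om, inner (nu om) (X om) = 0}.

(** Orthogonality is tested against each measurable null vector, with its own exceptional set; this
    replaces a measurable description of the random subspace spanned by the increments. *)
Definition perp (p : Om -> 'rV[R]_d) : Prop :=
  forall nu, nul nu -> {ae P, forall om, inner (p om) (nu om) = 0}.

Lemma gmeas_vec f : vec_meas G f <-> gmeas f.
Proof.
split=> [/(meas_wrtP _ sG)/measurable_rowP //|mf].
by apply/(meas_wrtP _ sG)/measurable_rowP.
Qed.

Lemma gmeas_measurable f : gmeas f -> forall i, measurable_fun setT (fun om => f om 0 i).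
Proof. by move=> mf i; apply: (sub_measurable_fun sG Gm); exact: mf. Qed.

Lemma gmeasD f g : gmeas f -> gmeas g -> gmeas (fun om => f om + g om).
Proof.
move=> mf mg i; rewrite (_ : (fun om => _) = (fun om => f om 0 i + g om 0 i)).
  exact: measurable_funD.
by apply/funext => om; rewrite mxE.
Qed.

Lemma gmeasZ (a : Om -> R) f : measurable_fun setT (a : gT -> R) -> gmeas f ->
  gmeas (fun om => a om *: f om).
Proof.
move=> ma mf i; rewrite (_ : (fun om => _) = (fun om => a om * f om 0 i)).
  exact: measurable_funM.
by apply/funext => om; rewrite mxE.
Qed.

Lemma gmeasB f g : gmeas f -> gmeas g -> gmeas (fun om => f om - g om).
Proof.
move=> mf mg; rewrite (_ : (fun om => _) = fun om => f om + (-1) *: g om).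
  by apply: gmeasD => //; exact: gmeasZ.
by apply/funext => om; rewrite scaleN1r.
Qed.

Lemma gmeas_inner f g : gmeas f -> gmeas g ->
  measurable_fun setT ((fun om => inner (f om) (g om)) : gT -> R).
Proof.
by move=> mf mg; apply: measurable_sum => i; exact: measurable_funM.
Qed.

(** The coordinatewise limsup is defined and [G]-measurable everywhere, and it is the limit wherever
    the sequence converges. *)
Lemma gmeas_ae_lim (f : nat -> Om -> 'rV[R]_d) : (forall n, gmeas (f n)) ->
  {ae P, forall om, forall i, cvgn (fun n => f n om 0 i)} ->
  exists2 g, gmeas g &
    {ae P, forall om, forall i, (fun n => f n om 0 i) @ \oo --> g om 0 i}.
Proof.
move=> mf cf.
exists (fun om => \row_i fine (limn_esup (fun n => (f n om 0 i)%:E))).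
  move=> i; rewrite (_ : (fun om => _) =
    fine \o (fun om => limn_esup (fun n => (f n om 0 i)%:E))).
    apply: measurableT_comp => //; apply: measurable_fun_limn_esup => n.
    by apply/measurable_EFinP; exact: mf.
  by apply/funext => om; rewrite mxE.
move: cf; apply: filterS => om cf i; rewrite mxE.
have /cvg_ex[l fl] := cf i.
have : (fun n => (f n om 0 i)%:E) @ \oo --> l%:E by apply: cvg_EFin => //; exact: nearW.
by move=> /cvg_esups h; rewrite limn_esup_lim (cvg_lim _ h).
Qed.

Definition midvec (f g : Om -> 'rV[R]_d) (om : Om) : 'rV[R]_d :=
  2^-1 *: (f om + g om).

Lemma midvecE f g om i : midvec f g om 0 i = (f om 0 i + g om 0 i) / 2.
Proof. by rewrite !mxE mulrC. Qed.

Lemma gmeas_midvec f g : gmeas f -> gmeas g -> gmeas (midvec f g).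
Proof. by move=> mf mg; apply: gmeasZ => //; exact: gmeasD. Qed.

Lemma inner_midvec f g om x :
  inner (midvec f g om) x = (inner (f om) x + inner (g om) x) / 2.
Proof. by rewrite /midvec innerZl innerDl mulrC. Qed.

Lemma nulZ (a : Om -> R) nu : measurable_fun setT (a : gT -> R) -> nul nu ->
  nul (fun om => a om *: nu om).
Proof.
move=> ma [mnu nu0]; split; first exact: gmeasZ.
by move: nu0; apply: filterS => om; rewrite innerZl => ->; rewrite mulr0.
Qed.

(** [p] minimizes a weighted norm among the vectors that differ from [phi] by a null vector.
    Competitors may be moved along [nu] with a random [G]-measurable coefficient, so minimality
    gives orthogonality pointwise and not just on average. *)
Lemma proj_exists (phi : Om -> 'rV[R]_d) : gmeas phi ->
  exists p, [/\ gmeas p, perp p & nul (fun om => phi om - p om)].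
Proof.
move=> mphi.
(* With this weight [phi] itself has norm at most 1, whatever its integrability. *)
pose w om : R := (1 + \sum_i (phi om 0 i) ^+ 2)^-1.
have s0 (v : 'rV[R]_d) : 0 <= \sum_i (v 0 i) ^+ 2.
  by apply: sumr_ge0 => i _; rewrite sqr_ge0.
have w0 om : 0 < w om by rewrite invr_gt0 ltr_pwDl.
have mw : measurable_fun setT w.
  apply: (measurableT_comp (@measurable_invr R)).
  apply: measurable_funD => //; apply: measurable_sum => i.
  by apply: measurable_funX; exact: gmeas_measurable.
pose c (v : Om -> 'rV[R]_d) (i : 'I_d) om := v om 0 i.
pose C := [set v | gmeas v /\ nul (fun om => phi om - v om)].
have Cphi : C phi.
  split => //; split; first exact: gmeasB.
  by apply: aeW => om /=; rewrite subrr inner0l.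
have mC v : C v -> forall i, measurable_fun setT (c v i).
  by move=> [mv _] i; exact: gmeas_measurable.
have phi1 : (wnorm P c w phi <= 1%:E)%E.
  apply: (@le_trans _ _ (\int[P]_om (cst 1%:E om))%E).
    apply: ge0_le_integral => //.
    - by move=> om _; rewrite lee_fin wsq_ge0.
    - by apply/measurable_EFinP; apply: measurable_wsq => //; exact: mC.
    - move=> om _; rewrite lee_fin /wsq /w mulrC ler_pdivrMr ?mul1r ?ltr_pwDl//.
      by rewrite lerDr ler01.
  by rewrite integral_cst//= mul1e probability_setT.
have [v [vC vcvg vmin]] : exists v : nat -> Om -> 'rV[R]_d, [/\ forall n, C (v n),
    {ae P, forall om, forall i, cvgn (fun n => c (v n) i om)} &
    forall r : R, (nat -> exists2 x, C x & (wnorm P c w x <= r%:E)%E) ->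
      forall k, (wnorm P c w (v k) <= (r + 16^-1 ^+ k.+1)%:E)%E].
  apply: (@near_minimizers_cvg _ _ _ P _ _ c midvec w _ w0 mw (fun=> C) 1) => //.
  - by move=> x y i om; exact: midvecE.
  - by move=> _ x.
  - move=> _ x y [mx [_ nx]] [my [_ ny]]; split; first exact: gmeas_midvec.
    split; first by apply: gmeasB => //; exact: gmeas_midvec.
    move: nx ny; apply: filterS2 => om.
    rewrite !innerDl !innerNl inner_midvec => ? ?; lra.
  - by move=> _; exists phi.
have [p mp vp] := gmeas_ae_lim (fun n => (vC n).1) vcvg.
have Cp : C p.
  split => //; split; first exact: gmeasB.
  have : {ae P, forall om, forall n, inner (phi om - v n om) (X om) = 0}.
    by apply: ae_foralln => n; exact: (vC n).2.2.
  move: vp; apply: filterS2 => om vp h0.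
  have : (fun n => inner (phi om - v n om) (X om)) @ \oo --> inner (phi om - p om) (X om).
    apply: cvg_inner => i; rewrite !mxE; under eq_fun do rewrite !mxE.
    by apply: cvgB; [exact: cvg_cst|exact: vp].
  under eq_fun do rewrite h0.
  by move=> h; apply/esym; apply: (cvg_unique _ _ h) => //; exact: cvg_cst.
have pmin x : C x -> (wnorm P c w p <= wnorm P c w x)%E.
  move=> Cx; have : (0 <= wnorm P c w x)%E.
    by apply: integral_ge0 => om _; rewrite lee_fin wsq_ge0.
  case xE : (wnorm P c w x) => [r| |]//; last by move=> _; exact: leey.
  move=> _; apply: (@fatou_ae_le _ _ _ _ (fun n om => (wsq w (c (v n)) om)%:E) _
    (fun k => r + 16^-1 ^+ k.+1)) => //.
  - by move=> n; apply/measurable_EFinP; apply: measurable_wsq => //; exact: mC.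
  - by apply/measurable_EFinP; apply: measurable_wsq => //; exact: mC.
  - by move=> n om; rewrite lee_fin wsq_ge0.
  - by move=> om; rewrite lee_fin wsq_ge0.
  - move: vp; apply: filterS => om vp.
    suff h : (fun n => (wsq w (c (v n)) om)%:E) @ \oo --> (wsq w (c p) om)%:E.
      by have [-> _] := cvg_limn_einf_sup h.
    apply: cvg_EFin => //; first exact: nearW.
    rewrite /wsq; apply: cvgMr; apply: cvg_big => //=; first exact: add_continuous.
    by move=> i _; rewrite /comp/=; under eq_fun do rewrite expr2; apply: cvgM; exact: vp.
  - by move=> n; apply: vmin => _; exists x => //; rewrite xE.
  - rewrite -[X in _ --> X]addr0; apply: cvgD; first exact: cvg_cst.
    rewrite (_ : (fun k => _) = (fun k => geometric 16^-1 16^-1 k)).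
      by apply: cvg_geometric; rewrite gtr0_norm; lra.
    by apply/funext => k; rewrite /geometric/= exprS.
exists p; split => //; last exact: Cp.2.
move=> nu nnu.
(* The coefficient of the pointwise projection of [p] on [nu]; division by zero makes it 0 where
   [nu] vanishes. *)
pose l om := inner (p om) (nu om) / inner (nu om) (nu om).
have ml : measurable_fun setT (l : gT -> R).
  apply: measurable_funM; first by apply: gmeas_inner => //; exact: nnu.1.
  apply: (measurableT_comp (@measurable_invr R)).
  by apply: gmeas_inner; exact: nnu.1.
pose p' om := p om - l om *: nu om.
have nl := nulZ ml nnu.
have Cp' : C p'.
  split; first by apply: gmeasB => //; exact: nl.1.
  split; first by apply: gmeasB => //; apply: gmeasB => //; exact: nl.1.
  move: Cp.2.2 nl.2; apply: filterS2 => om.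
  by move=> h1 h2; rewrite /p' opprB addrCA innerDl h1 h2 addr0.
(* The exact decrease of the weighted square when [p] is replaced by [p']; minimality forces its
   integral to be 0. *)
pose dl om := w om * (inner (p om) (nu om) * l om).
have dl0 om : 0 <= dl om.
  rewrite mulr_ge0 ?(ltW (w0 _))// /l mulrA divr_ge0// -?expr2 ?sqr_ge0//.
  by rewrite /inner sumr_ge0// => i _; rewrite -expr2 sqr_ge0.
have sqE y om : wsq w (c y) om = w om * inner (y om) (y om).
  by congr (_ * _); apply: eq_bigr => i _; rewrite expr2.
have pE om : wsq w (c p) om = wsq w (c p') om + dl om.
  rewrite !sqE /dl -mulrDr; congr (_ * _).
  rewrite /p' !innerDl !(innerC _ (_ - _)) !innerDl !innerNl !innerZl.
  rewrite !(innerC _ (- _)) !innerNl !innerZl.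
  rewrite (innerC (nu om) (p om)).
  have [n0|n0] := eqVneq (inner (nu om) (nu om)) 0.
    by rewrite /l n0 invr0; ring.
  by rewrite /l; field; exact: n0.
have mdl : measurable_fun setT dl.
  apply: measurable_funM => //; apply: (sub_measurable_fun sG Gm).
  by apply: measurable_funM => //; apply: gmeas_inner => //; exact: nnu.1.
have mwsq x : C x -> measurable_fun setT (fun om => (wsq w (c x) om)%:E).
  by move=> Cx; apply/measurable_EFinP; apply: measurable_wsq => //; exact: mC.
have sumE : (wnorm P c w p = wnorm P c w p' + \int[P]_om `|(dl om)%:E|)%E.
  rewrite /wnorm -ge0_integralD//.
  - by apply: eq_integral => om _; rewrite pE EFinD gee0_abs// lee_fin.
  - by move=> om _; rewrite lee_fin wsq_ge0.
  - exact: mwsq.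
  - by apply: measurableT_comp => //; exact/measurable_EFinP.
have : (\int[P]_om `|(dl om)%:E| = 0)%E.
  have i0 : (0 <= \int[P]_om `|(dl om)%:E|)%E by apply: integral_ge0.
  have p'0 : (0 <= wnorm P c w p')%E.
    by apply: integral_ge0 => om _; rewrite lee_fin wsq_ge0.
  have pfin := le_trans (pmin _ Cphi) phi1.
  have := pmin _ Cp'; move: pfin p'0 i0; rewrite sumE.
  case: (wnorm P c w p') => [a| |]//; case: (\int[P]_om _)%E => [b| |]//.
  rewrite -EFinD !lee_fin => _ _ b0; rewrite gerDl => b0'.
  by congr (_%:E); apply/eqP; rewrite eq_le b0' b0.
move=> /(ae_eq_integral_abs P measurableT ((measurable_EFinP _ _).2 mdl)).
apply: filterS => om /= /(_ Logic.I) [] /eqP.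
rewrite /dl /l !mulf_eq0 gt_eqF// orFb orbA orbb invr_eq0 => /orP[/eqP//|/eqP].
by move=> /inner_self_eq0 ->; rewrite innerC inner0l.
Qed.

End OnePeriod.

(** The least index, with default 0 where no [E n] holds; the default accounts for the second piece
    in the description of [idx x = n]. *)
Lemma measurable_first_index (d : measure_display) (T : measurableType d)
    (E : nat -> set T) : (forall n, measurable (E n)) ->
  exists idx : T -> nat, (forall n, measurable [set x | idx x = n]) /\
    forall x, (exists n, E n x) -> E (idx x) x.
Proof.
move=> mE.
pose ex x (h : exists n, E n x) : exists n, `[< E n x >] :=
  let: ex_intro n p := h in ex_intro _ n (asboolT p).
pose idx x := if pselect (exists n, E n x) is left h then ex_minn (ex x h) else 0%N.
have idxE x n : (exists m, E m x) ->
    idx x = n <-> E n x /\ forall m, (m < n)%N -> ~ E m x.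
  move=> h; rewrite /idx; case: pselect => // h'; case: ex_minnP => m /asboolP Em mmin.
  split=> [<-|[En nmin]].
    by split => // k km Ek; have := mmin k (asboolT Ek); rewrite leqNgt km.
  apply/eqP; rewrite eqn_leq mmin ?asboolT//=.
  by rewrite leqNgt; apply/negP => /nmin.
exists idx; split; last first.
  by move=> x h; have /(idxE _ _ h)[] := erefl (idx x).
move=> n.
have mU : measurable (\bigcup_m E m) by exact: bigcupT_measurable.
rewrite (_ : mkset _ = (E n `\` \bigcup_(m in [set m | (m < n)%N]) E m) `|`
    ([set _ | n = 0%N] `&` ~` (\bigcup_m E m))).
  apply: measurableU.
    by apply: measurableD => //; exact: bigcup_measurable.
  apply: measurableI; last exact: measurableC.
  have [->|/eqP n0] := eqVneq n 0%N.
    by rewrite (_ : mkset _ = setT)//; apply/seteqP; split.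
  by rewrite (_ : mkset _ = set0)//; apply/seteqP; split.
apply/seteqP; split => x /=.
  have [h|h] := pselect (exists m, E m x).
    move=> /(idxE _ _ h)[En nmin]; left; split => // -[m /= mn Em].
    exact: nmin mn Em.
  rewrite /idx; case: pselect => // _ <-; right; split => // -[m _ Em].
  by apply: h; exists m.
move=> [[En nE]|[-> nE]].
  apply/idxE; first by exists n.
  by split => // m mn Em; apply: nE; exists m.
rewrite /idx; case: pselect => // -[m Em]; exfalso; apply: nE; by exists m.
Qed.

Lemma measurable_fun_glue (d d' : measure_display) (T : measurableType d)
    (T' : measurableType d') (g : nat -> T -> T') (idx : T -> nat) :
  (forall n, measurable [set x | idx x = n]) ->
  (forall n, measurable_fun setT (g n)) ->
  measurable_fun setT (fun x => g (idx x) x).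
Proof.
move=> mi mg _ B mB; rewrite setTI.
rewrite (_ : _ @^-1` _ = \bigcup_n ([set x | idx x = n] `&` (g n @^-1` B))).
  apply: bigcupT_measurable => n; apply: measurableI => //.
  by rewrite -[X in measurable X]setTI; exact: mg.
apply/seteqP; split => [x Bx|x [n _ [/= <-]]//].
by exists (idx x).
Qed.

Section Boundedness.
Context (R : realType) (d : nat) (dO : measure_display) (Om : measurableType dO).
Variables (P : probability Om R) (G : set (set Om)).
Hypotheses (sG : sigma_algebra setT G) (Gm : G `<=` measurable).
Local Notation gT := (g_sigma_algebraType G).
Variable X : Om -> 'rV[R]_d.
Hypothesis na : forall h, gmeas G h ->
  {ae P, forall om, 0 <= inner (h om) (X om)} ->
  {ae P, forall om, inner (h om) (X om) = 0}.
Variables (f : nat -> Om -> 'rV[R]_d) (Y : Om -> R).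
Hypotheses (mf : forall n, gmeas G (f n)) (pf : forall n, perp P G X (f n)).
Hypothesis Y0 : forall om, 0 <= Y om.
Hypothesis fY : {ae P, forall om, forall n, - Y om <= inner (f n om) (X om)}.

Definition peak (i : 'I_d) (s : R) (k n : nat) : set Om :=
  [set om | k.+1%:R <= s * f n om 0 i /\
            forall j, `|f n om 0 j| <= s * f n om 0 i].

(** An unbounded sequence has peaks of every level for one of the finitely many pairs of coordinate
    and sign, so boundedness reduces to showing each of these sets null. *)
Definition peaks (i : 'I_d) (s : R) : set Om :=
  [set om | forall k, exists n, peak i s k n om].

Lemma measurable_peak i s k n : measurable (peak i s k n : set gT).
Proof.
have mle (a b : gT -> R) : measurable_fun setT a -> measurable_fun setT b ->
    measurable [set x | a x <= b x].
  move=> ma mb; rewrite (_ : mkset _ = setT `&` (fun x => b x - a x) @^-1` `[0, +oo[).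
    by apply: measurable_funB.
  by rewrite setTI; apply/seteqP; split => x /=; rewrite in_itv/= andbT subr_ge0.
have mfi : measurable_fun setT ((fun om => s * f n om 0 i) : gT -> R).
  by apply: measurable_funM => //; exact: mf.
rewrite (_ : peak i s k n = [set om | k.+1%:R <= s * f n om 0 i] `&`
   \bigcap_(j in [set: 'I_d]) [set om | `|f n om 0 j| <= s * f n om 0 i]).
  apply: measurableI; first exact: mle.
  apply: fin_bigcap_measurable => [|j _]; first exact: finite_finset.
  by apply: mle => //; apply: measurableT_comp => //; exact: mf.
apply/seteqP; split => om [h1 h2]; split => // j; [move=> _|]; exact: h2.
Qed.

Lemma measurable_peaks i s : measurable (peaks i s : set gT).
Proof.
rewrite (_ : peaks i s = \bigcap_k \bigcup_n peak i s k n).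
  by apply: bigcapT_measurable => k; apply: bigcupT_measurable => n;
    exact: measurable_peak.
apply/seteqP; split => [om h k _|om h k].
  by have [n hn] := h k; exists n.
by have [n _ hn] := h k Logic.I; exists n.
Qed.

(* Rescaling f at its peaks gives vectors of sup norm 1 whose pairing with X is
   asymptotically nonnegative; fixing the coordinate i where the norm is attained
   keeps this normalization stable under convex combinations. *)
Lemma peaks_null i s : s ^+ 2 = 1 -> {ae P, forall om, ~ peaks i s om}.
Proof.
move=> s1; pose A := peaks i s.
have s0 : s != 0.
  by apply/eqP => s0; move: s1 => /eqP; rewrite s0 expr0n eq_sym oner_eq0.
(* All four conditions survive midpoints and limits. The lower bound tends to 0 with [k], while the
   fixed coordinate on [A] keeps the limit from vanishing there. *)
pose C k := [set h : Om -> 'rV[R]_d | [/\ gmeas G h, perp P G X h,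
  {ae P, forall om, - (Y om / k.+1%:R) <= inner (h om) (X om)} &
  {ae P, forall om, A om -> h om 0 i = s}]].
pose c (v : Om -> 'rV[R]_d) (j : 'I_d) om := v om 0 j.
have mC k v : C k v -> forall j, measurable_fun setT (c v j).
  by move=> [mv _ _ _]; exact: (gmeas_measurable sG Gm mv).
have Cex k : exists2 h, C k h & (wnorm P c (fun=> 1%R) h <= d%:R%:E)%E.
  have [idx [midx idxP]] := measurable_first_index (measurable_peak i s k).
  (* A peak of level [k], chosen [G]-measurably, divided by its sup norm and set to 0 off [A]. Its
     entries are at most 1 in absolute value, whence the norm bound [d]. *)
  pose h om : 'rV[R]_d :=
    (\1_A om * (s * f (idx om) om 0 i)^-1) *: f (idx om) om.
  have hk om : A om -> peak i s k (idx om) om by move=> Aom; apply/idxP/Aom.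
  have mfi j : measurable_fun setT ((fun om => f (idx om) om 0 j) : gT -> R).
    by apply: (@measurable_fun_glue _ _ gT R (fun n om => f n om 0 j)) => // n; exact: mf.
  have mh : gmeas G h.
    apply: gmeasZ; last exact: mfi.
    apply: measurable_funM; first by apply: measurable_indic; exact: measurable_peaks.
    by apply: (measurableT_comp (@measurable_invr R)); apply: measurable_funM.
  have hpos om : A om -> 0 < s * f (idx om) om 0 i.
    by move=> /hk[h1 _]; exact: lt_le_trans h1.
  have Ch : C k h.
    split => //.
    - move=> nu nnu.
      have : {ae P, forall om, forall n, inner (f n om) (nu om) = 0}.
        by apply: ae_foralln => n; exact: pf.
      by apply: filterS => om h0; rewrite /h innerZl h0 mulr0.
    - move: fY; apply: filterS => om hY; rewrite /h innerZl indicE.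
      have [Aom|nA] := pselect (A om); last first.
        by rewrite memNset// !mul0r oppr_le0 divr_ge0.
      rewrite mem_set// mul1r; have [h1 _] := hk _ Aom; have hp := hpos _ Aom.
      apply: (@le_trans _ _ (- (Y om / (s * f (idx om) om 0 i)))).
        by rewrite lerN2 ler_wpM2l// lef_pV2 ?posrE.
      by rewrite -mulNr [leRHS]mulrC ler_wpM2r// invr_ge0 ltW.
    - apply: aeW => om Aom; rewrite mxE indicE mem_set// mul1r.
      have hp := hpos _ Aom.
      rewrite invfM -mulrA mulVf ?mulr1; last first.
        by apply/eqP => f0; move: hp; rewrite f0 mulr0 ltxx.
      by apply: (mulfI s0); rewrite mulfV// -expr2.
  exists h => //.
  apply: (@le_trans _ _ (\int[P]_om (cst d%:R%:E om))%E).
    apply: ge0_le_integral => //.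
    - by move=> om _; rewrite lee_fin wsq_ge0// => ?; exact: ltr01.
    - by apply/measurable_EFinP; apply: measurable_wsq => //; exact: mC Ch.
    - move=> om _; rewrite lee_fin /wsq mul1r.
      have -> : d%:R = \sum_(j < d) 1 :> R by rewrite sumr_const card_ord.
      apply: ler_sum => j _; rewrite /c mxE indicE.
      have [Aom|nA] := pselect (A om); last first.
        by rewrite memNset// !mul0r expr0n/= ler01.
      rewrite mem_set// mul1r; have [_ /(_ j) hj] := hk _ Aom; have hp := hpos _ Aom.
      rewrite -real_normK ?num_real// expr_le1// normrM normfV (gtr0_norm hp).
      by rewrite mulrC ler_pdivrMr// mul1r.
  by rewrite integral_cst//= probability_setT mule1.
have [v [vC vcvg _]] : exists v : nat -> Om -> 'rV[R]_d, [/\ forall n, C n (v n),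
    {ae P, forall om, forall j, cvgn (fun n => c (v n) j om)} &
    forall r : R, (forall n, exists2 x, C n x & (wnorm P c (fun=> 1%R) x <= r%:E)%E) ->
      forall k, (wnorm P c (fun=> 1%R) (v k) <= (r + 16^-1 ^+ k.+1)%:E)%E].
  apply: (@near_minimizers_cvg _ _ _ P _ _ c (@midvec _ _ _ _) (fun=> 1) _ _ _ C d%:R) => //.
  - by move=> x y j om; exact: midvecE.
  - move=> n h [mh ph hY hA]; split => //.
    move: hY; apply: filterS => om; apply: le_trans.
    by rewrite lerN2 ler_wpM2l// lef_pV2 ?posrE// ler_nat.
  - move=> n x y [mx px xY xA] [my py yY yA]; split.
    + exact: gmeas_midvec.
    + move=> nu nnu; move: (px nu nnu) (py nu nnu); apply: filterS2 => om.
      by rewrite inner_midvec => -> ->; rewrite addr0 mul0r.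
    + move: xY yY; apply: filterS2 => om; rewrite inner_midvec.
      by move: (Y om / _) (inner _ _) (inner _ _) => a b b'; lra.
    + move: xA yA; apply: filterS2 => om hx hy Aom.
      by rewrite midvecE hx// hy//; field.
have [h mh vh] := gmeas_ae_lim (fun n => let: And4 a _ _ _ := vC n in a) vcvg.
have hX0 : {ae P, forall om, inner (h om) (X om) = 0}.
  apply: na => //.
  have : {ae P, forall om, forall n, - (Y om / n.+1%:R) <= inner (v n om) (X om)}.
    by apply: ae_foralln => n; have [] := vC n.
  move: vh; apply: filterS2 => om vh hn.
  have h1 := cvg_inner (x := X om) vh.
  have h2 : (fun n => - (Y om / n.+1%:R)) @ \oo --> (0 : R).
    rewrite -oppr0 -(mulr0 (Y om)); apply: cvgN; apply: cvgMr.
    exact: cvg_harmonic.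
  by apply: (ler_cvg_to h2 h1); exact: nearW.
(* No arbitrage has made [h] a null vector, and every [v n] is orthogonal to null vectors; in the
   limit [h] is orthogonal to itself, so it is 0. *)
have hh0 : {ae P, forall om, inner (h om) (h om) = 0}.
  have : {ae P, forall om, forall n, inner (v n om) (h om) = 0}.
    by apply: ae_foralln => n; have [_ + _ _] := vC n; apply.
  move: vh; apply: filterS2 => om vh hn.
  have := cvg_inner (x := h om) vh; under eq_fun do rewrite hn.
  by move=> h1; apply/esym; apply: (cvg_unique _ _ h1) => //; exact: cvg_cst.
have vA : {ae P, forall om, forall n, A om -> v n om 0 i = s}.
  by apply: ae_foralln => n; have [] := vC n.
have hv : {ae P, forall om, (forall n, A om -> v n om 0 i = s) /\
    forall j, (fun n => v n om 0 j) @ \oo --> h om 0 j}.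
  by move: vA vh; apply: filterS2.
move: hv hh0; apply: filterS2 => om [hA vh'] /inner_self_eq0 h0 Aom.
have := vh' i; under eq_fun do rewrite hA//.
move=> h1; have : s = h om 0 i by apply: (cvg_unique _ _ h1) => //; exact: cvg_cst.
by rewrite h0 mxE => /eqP; apply/negP.
Qed.

Lemma perp_bounded :
  {ae P, forall om, exists M : R, forall n i, `|f n om 0 i| <= M}.
Proof.
have sgn b : ((-1) ^+ b : R) ^+ 2 = 1 by rewrite sqrr_sign.
have : {ae P, forall om, forall ib : 'I_d * bool, ~ peaks ib.1 ((-1) ^+ ib.2) om}.
  by apply: ae_forall_countable => ib; exact: peaks_null.
apply: filterS => om hom.
have /choice[K KP] : forall ib : 'I_d * bool, exists k, forall n,
    ~ peak ib.1 ((-1) ^+ ib.2) k n om.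
  move=> ib; apply: contrapT => h; apply: (hom ib) => k.
  by apply: contrapT => hk; apply: h; exists k => n hn; apply: hk; exists n.
(* [K ib] is a level at which the pair [ib] has no peak. For each [n], the largest coordinate and
   its sign form a pair whose level bounds [f n om], and the sum dominates all these levels. *)
exists (\sum_ib (K ib).+1%:R) => n i.
pose j := [arg max_(j > i) `|f n om 0 j|]%O.
have jmax k : `|f n om 0 k| <= `|f n om 0 j|.
  by rewrite /j; case: arg_maxP => // m _ /(_ k); apply.
apply: le_trans (jmax i) _.
pose b := f n om 0 j < 0.
have nE : `|f n om 0 j| = (-1) ^+ b * f n om 0 j by rewrite normrEsign.
have : ~ (K (j, b)).+1%:R <= `|f n om 0 j|.
  move=> h; apply: (KP (j, b) n); split; first by rewrite -nE.
  by move=> k; rewrite -nE.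
move=> /negP; rewrite -ltNge => /ltW /le_trans; apply.
by rewrite (bigD1 (j, b))//= lerDl sumr_ge0.
Qed.

End Boundedness.

(** * Utility and expectation *)

(** The positive part has integral at most [M], so the convention for two infinite parts never
    applies, and the expectation is expressed by one nonnegative integral. *)
Lemma expectE (R : realType) (dO : measure_display) (Om : measurableType dO)
    (P : probability Om R) (f : Om -> \bar R) (M : R) :
  measurable_fun setT f -> 0 <= M -> (forall om, f om <= M%:E)%E ->
  expect P f = (M%:E - \int[P]_om (M%:E - f om))%E.
Proof.
move=> mf M0 fM; rewrite /expect.
have fpM om : (f^\+ om <= M%:E)%E by rewrite funeposE ge_max fM lee_fin.
have Mfp0 om : (0 <= M%:E - (f^\+)%E om)%E by rewrite sube_ge0 ?fpM// orbT.
have mfp : measurable_fun setT (f^\+)%E by exact: measurable_funepos.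
have mfn : measurable_fun setT (f^\-)%E by exact: measurable_funeneg.
have MfpE : (\int[P]_om (M%:E - f^\+ om) + \int[P]_om (f^\+ om) = M%:E)%E.
  rewrite -ge0_integralD//.
  - rewrite (eq_integral (cst M%:E)); last first.
      move=> om _; rewrite subeK// ge0_fin_numE//.
      exact: le_lt_trans (fpM om) (ltry _).
    by rewrite integral_cst//= probability_setT mule1.
  - by apply: emeasurable_funB.
have -> : (\int[P]_om (M%:E - f om) =
    \int[P]_om (M%:E - f^\+ om) + \int[P]_om (f^\- om))%E.
  rewrite -ge0_integralD//.
  - apply: eq_integral => om _; rewrite [in LHS](funeposneg f) funeposE funenegE.
    have := fM om; case: (f om) => [r| |]//=; rewrite ?lee_fin => _.
      by rewrite -!EFin_max -!EFinB -EFinD; congr (_%:E); ring.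
    by rewrite maxNye maxye.
  - by apply: emeasurable_funB.
have : (0 <= \int[P]_om (M%:E - f^\+ om))%E.
  by apply: integral_ge0 => om _; exact: Mfp0.
have : (0 <= \int[P]_om (f^\+ om))%E by apply: integral_ge0.
have : (0 <= \int[P]_om (f^\- om))%E by apply: integral_ge0.
move: MfpE; case: (\int[P]_om (M%:E - f^\+ om))%E => [a| |]//;
  case: (\int[P]_om (f^\+ om))%E => [p| |]//; case: (\int[P]_om (f^\- om))%E => [n| |]//=.
by move=> [<-] _ _ _; rewrite -!EFinD; congr (_%:E); ring.
Qed.

Section Utility.
Context (R : realType) (U : R -> \bar R).
Hypothesis UU : utility U.

Lemma utility_bounded : (lim (U x @[x --> +oo%R]) < +oo)%E ->
  exists2 M : R, 0 <= M & forall x, (U x <= M%:E)%E.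
Proof.
move=> limU; have [_ [Und _]] := UU.
have Ul : U x @[x --> +oo%R] --> ereal_sup (range U).
  by apply: nondecreasing_cvge => x y; exact: Und.
rewrite (cvg_lim _ Ul) // in limU.
have Ule x : (U x <= ereal_sup (range U))%E by apply: ereal_sup_ubound; exists x.
move: limU Ule; case: (ereal_sup _) => [s| |]// _ h.
  exists `|s|%R => // x; apply: le_trans (h x) _; by rewrite lee_fin ler_norm.
by exists 0 => // x; apply: le_trans (h x) _; rewrite leNye.
Qed.

Lemma measurable_utility : measurable_fun setT U.
Proof.
have [_ [_ [_ usc]]] := UU.
apply: (measurability _ (ErealGenInftyO.measurableE R)).
move=> _ [_ [r ->] <-]; rewrite setTI; apply: open_measurable.
rewrite openE => x /=; rewrite in_itv/= => /usc.
by apply: filterS => y; rewrite /= in_itv/=.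
Qed.

Variable M : R.
Hypothesis UM : forall x, (U x <= M%:E)%E.

Lemma disutility_ge0 x : (0 <= M%:E - U x)%E.
Proof.
have [Uy _] := UU; have := UM x; have := Uy x.
case: (U x) => [u _|//|_ _]; first by rewrite -EFinB !lee_fin subr_ge0.
by rewrite /= addey// leey.
Qed.

Lemma disutility_mid x y :
  (M%:E - U ((x + y) / 2)%R <= 2^-1%:E * (M%:E - U x) + 2^-1%:E * (M%:E - U y))%E.
Proof.
have [Uy [_ [cvx _]]] := UU.
have h01 : 0 < (2^-1 : R) < 1 by apply/andP; split; lra.
have := cvx x y _ h01.
have -> : 2^-1 * x + (1 - 2^-1) * y = (x + y) / 2 by field.
have -> : 1 - 2^-1 = 2^-1 :> R by field.
have := Uy x; have := Uy y; have := Uy ((x + y) / 2).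
case: (U x) => [a| |]//; case: (U y) => [b| |]//; case: (U _) => [z| |]//= _ _ _;
  rewrite ?gt0_muley ?lte_fin ?invr_gt0// ?addey ?addye ?leey//.
by rewrite -!EFinM -!EFinD -?EFinN !lee_fin; lra.
Qed.

Lemma disutility_lsc (u : nat -> R) (l : R) : u @ \oo --> l ->
  (M%:E - U l <= limn_einf (fun n => M%:E - U (u n)))%E.
Proof.
have [Uy [_ [_ usc]]] := UU.
move=> ul; apply: le_limn_einf => c cM.
have /usc Uc : (U l < (M - c)%:E)%E.
  move: cM (Uy l); case: (U l) => [a| |]//=; rewrite ?lte_fin ?ltNyr//; lra.
have : \forall n \near \oo, (U (u n) < (M - c)%:E)%E by exact: (ul _ Uc).
apply: filterS => n /=.
have := Uy (u n); case: (U (u n)) => [a| |]//= _; rewrite ?lte_fin ?lee_fin ?leey//; lra.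
Qed.

End Utility.

(** * Strategies and wealth *)

Lemma le_norm_inner (R : realType) (d : nat) (a b : 'rV[R]_d) (M : R) :
  (forall i, `|a 0 i| <= M) -> `|inner a b| <= M * \sum_i `|b 0 i|.
Proof.
move=> aM; rewrite (le_trans (ler_norm_sum _ _ _))// mulr_sumr.
by apply: ler_sum => i _; rewrite normrM ler_wpM2r.
Qed.

Section Wealth.
Context (R : realType) (d : nat) (dO : measure_display) (Om : measurableType dO).
Implicit Types (S phi psi : nat -> Om -> 'rV[R]_d) (w : R).

Lemma wealth0 S w phi om : wealth S w phi 0 om = w.
Proof. by rewrite /wealth big_geq// addr0. Qed.

Lemma wealthS S w phi t om :
  wealth S w phi t.+1 om = wealth S w phi t om + inner (phi t.+1 om) (incr S t.+1 om).
Proof. by rewrite /wealth big_nat_recr//= addrA. Qed.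

Definition midstrat phi psi (s : nat) : Om -> 'rV[R]_d := midvec (phi s) (psi s).

Lemma wealth_mid S w phi psi t om :
  wealth S w (midstrat phi psi) t om =
  (wealth S w phi t om + wealth S w psi t om) / 2.
Proof.
elim: t => [|t IH]; first by rewrite !wealth0; field.
by rewrite !wealthS IH inner_midvec; field.
Qed.

Lemma wealth_zero S w t om : wealth S w (fun _ _ => 0) t om = w.
Proof.
by rewrite /wealth big1 ?addr0// => s _; rewrite inner0l.
Qed.

Lemma cvg_wealth S w (v : nat -> nat -> Om -> 'rV[R]_d) phi t om :
  (forall s, (1 <= s <= t)%N -> forall i, (fun n => v n s om 0 i) @ \oo --> phi s om 0 i) ->
  (fun n => wealth S w (v n) t om) @ \oo --> wealth S w phi t om.
Proof.
elim: t => [|t IH] h.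
  by rewrite wealth0; under eq_fun do rewrite wealth0; exact: cvg_cst.
rewrite wealthS; under eq_fun do rewrite wealthS.
apply: cvgD; last by apply: cvg_inner; apply: h; rewrite leqnn.
by apply: IH => s /andP[s1 st]; apply: h; rewrite s1 (leq_trans st).
Qed.

End Wealth.

Section Market.
Context (R : realType) (d T : nat) (dO : measure_display) (Om : measurableType dO).
Variables (P : probability Om R) (F : nat -> set (set Om)).
Variable SS : set (nat -> Om -> 'rV[R]_d).
Hypothesis filtF : filtration P T F.
Hypothesis adaptS : forall S, SS S -> adapted T F S.
Variable Ss : nat -> Om -> 'rV[R]_d.
Hypothesis SsP : Sstar P T F SS Ss.
Implicit Types (S phi : nat -> Om -> 'rV[R]_d) (w : R).

Let sF t : (t <= T)%N -> sigma_algebra setT (F t).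
Proof. by have [_ [+ _]] := filtF; exact. Qed.

Let mF t : (t <= T)%N -> F t `<=` measurable.
Proof. by have [_ [_ [+ _]]] := filtF; exact. Qed.

Let pT s : (1 <= s <= T)%N -> (s.-1 <= T)%N.
Proof. by move=> /andP[_]; exact: leq_trans (leq_pred _). Qed.

Lemma measurable_incr S t : SS S -> (1 <= t <= T)%N ->
  forall i, measurable_fun setT (fun om => incr S t om 0 i).
Proof.
move=> SSS t1T i; have tT := pT t1T; have /andP[_ t1] := t1T.
rewrite (_ : (fun om => _) = (fun om => S t om 0 i - S t.-1 om 0 i)).
  apply: measurable_funB.
    apply: (gmeas_measurable (sF t1) (mF t1)).
    by apply/(gmeas_vec (sF t1)); exact: adaptS.
  apply: (gmeas_measurable (sF tT) (mF tT)).
  by apply/(gmeas_vec (sF tT)); exact: adaptS.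
by apply/funext => om; rewrite !mxE.
Qed.

Lemma predictableP phi : predictable T F phi <->
  forall s, (1 <= s <= T)%N -> gmeas (F s.-1) (phi s).
Proof.
by split => h s sT; have := h s sT; move/(gmeas_vec (sF (pT sT))).
Qed.

Lemma measurable_strategy phi : predictable T F phi ->
  forall s, (1 <= s <= T)%N -> forall i, measurable_fun setT (fun om => phi s om 0 i).
Proof.
move=> /predictableP mphi s sT.
exact: (gmeas_measurable (sF (pT sT)) (mF (pT sT)) (mphi s sT)).
Qed.

Lemma measurable_wealth S w phi t : SS S -> predictable T F phi -> (t <= T)%N ->
  measurable_fun setT (wealth S w phi t).
Proof.
move=> SSS mphi; elim: t => [|t IH] tT.
  rewrite (_ : wealth _ _ _ _ = cst w); first exact: measurable_cst.
  by apply/funext => om; rewrite wealth0.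
rewrite (_ : wealth _ _ _ _ = (fun om => wealth S w phi t om +
    inner (phi t.+1 om) (incr S t.+1 om))).
  apply: measurable_funD; first exact/IH/ltnW.
  apply: measurable_sum => i; apply: measurable_funM.
    exact: measurable_strategy.
  exact: measurable_incr.
by apply/funext => om; rewrite wealthS.
Qed.

(** The strategy that holds [h] in period [t] and nothing otherwise has terminal wealth
    [inner h (incr Ss t)]. *)
Lemma NA_one_period t : (1 <= t <= T)%N -> forall h, gmeas (F t.-1) h ->
  {ae P, forall om, 0 <= inner (h om) (incr Ss t om)} ->
  {ae P, forall om, inner (h om) (incr Ss t om) = 0}.
Proof.
move=> tT h mh h0; have [_ [na _]] := SsP.
pose phi s : Om -> 'rV[R]_d := if s == t then h else fun=> 0.
have wE om : wealth Ss 0 phi T om = inner (h om) (incr Ss t om).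
  rewrite /wealth add0r (bigD1_seq t)/= ?iota_uniq//; last first.
    by rewrite mem_index_iota ltnS.
  rewrite /phi eqxx big1 ?addr0// => s /negPf ->.
  by rewrite inner0l.
have : {ae P, forall om, wealth Ss 0 phi T om = 0}.
  apply: na; last by move: h0; apply: filterS => om; rewrite wE.
  apply/predictableP => s sT; rewrite /phi; case: eqVneq => [->//|_] i.
  under eq_fun do rewrite mxE; exact: measurable_cst.
by apply: filterS => om; rewrite wE.
Qed.

Definition perp_strategy phi := forall s, (1 <= s <= T)%N ->
  perp P (F s.-1) (incr Ss s) (phi s).

Lemma perp_strategy_exists phi : predictable T F phi ->
  exists phi', [/\ predictable T F phi', perp_strategy phi' &
    forall S, SS S -> forall w,
      {ae P, forall om, forall t, (t <= T)%N -> wealth S w phi' t om = wealth S w phi t om}].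
Proof.
move=> mphi.
have /choice[phi' h] : forall s, exists p, (1 <= s <= T)%N ->
    [/\ gmeas (F s.-1) p, perp P (F s.-1) (incr Ss s) p &
        nul P (F s.-1) (incr Ss s) (fun om => phi s om - p om)].
  move=> s; have [sT|] := boolP (1 <= s <= T)%N; last by exists (phi s).
  have [p pP] := proj_exists P (sF (pT sT)) (mF (pT sT)) (incr Ss s)
    ((predictableP phi).1 mphi s sT).
  by exists p.
exists phi'; split.
- by apply/predictableP => s sT; have [] := h s sT.
- by move=> s sT; have [] := h s sT.
move=> S SSS w.
have : {ae P, forall om, forall s, (1 <= s <= T)%N ->
    inner (phi s om - phi' s om) (incr S s om) = 0}.
  apply: ae_foralln => s; have [sT|] := boolP (1 <= s <= T)%N; last first.
    by move=> _; apply: aeW.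
  have [_ _ [mn n0]] := h s sT; have [SSs [_ DS]] := SsP.
  have : {ae P, forall om, inner (phi s om - phi' s om) (incr S s om) = 0}.
    apply: (orth_transfer (sF (pT sT)) (mF (pT sT)) _ _ (DS S SSS s sT) _ n0).
    - by apply/measurable_rowP; exact: measurable_incr.
    - by apply/measurable_rowP; exact: measurable_incr.
    - exact/(gmeas_vec (sF (pT sT))).
  by apply: filterS => om ? _.
apply: filterS => om h0; elim => [|t IH] tT; first by rewrite !wealth0.
rewrite !wealthS IH ?(ltnW tT)//; congr (_ + _).
by apply/eqP; rewrite eq_sym -subr_eq0 -innerNl -innerDl; apply/eqP/h0.
Qed.

Section BoundedStrategies.
Variables (w : R) (Phi : nat -> nat -> Om -> 'rV[R]_d).
Hypothesis mPhi : forall n, predictable T F (Phi n).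
Hypothesis pPhi : forall n, perp_strategy (Phi n).
Hypothesis wPhi : forall n t, (t <= T)%N ->
  {ae P, forall om, 0 <= wealth Ss w (Phi n) t om}.

Let wealth_bounded t := {ae P, forall om, exists B : R, forall n,
  `|wealth Ss w (Phi n) t om| <= B}.

Let strategy_bounded t := {ae P, forall om, exists B : R, forall n i,
  `|Phi n t om 0 i| <= B}.

(** Nonnegative wealth at [t.+1] says that the gain of the period is at least minus the wealth at
    [t], which is bounded below uniformly in [n]; this is the hypothesis of [perp_bounded]. *)
Lemma bounded_step t : (t < T)%N -> wealth_bounded t -> strategy_bounded t.+1.
Proof.
move=> tT wb.
(* [Y] is chosen outcome by outcome, with value 0 where the wealth is unbounded, so that it is
   nonnegative everywhere. *)
have /choice[Y YP] : forall om, exists B : R, 0 <= B /\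
    ((exists B' : R, forall n, `|wealth Ss w (Phi n) t om| <= B') ->
     forall n, `|wealth Ss w (Phi n) t om| <= B).
  move=> om; have [[B hB]|h] := pselect (exists B' : R, forall n,
      `|wealth Ss w (Phi n) t om| <= B').
    by exists B; split => //; exact: le_trans (hB 0%N).
  by exists 0; split => // /h.
have sT : (1 <= t.+1 <= T)%N by [].
apply: (@perp_bounded _ _ _ _ P (F t) (sF (ltnW tT)) (mF (ltnW tT))
  (incr Ss t.+1) (NA_one_period sT) (fun n => Phi n t.+1) Y).
- by move=> n; exact: (predictableP _).1 (mPhi n) _ sT.
- by move=> n; exact: pPhi n _ sT.
- by move=> om; have [] := YP om.
have : {ae P, forall om, forall n, 0 <= wealth Ss w (Phi n) t.+1 om}.
  by apply: ae_foralln => n; exact: wPhi.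
move: wb; apply: filterS2 => om hB h0 n; have [_ /(_ hB n) hY] := YP om.
have := h0 n; rewrite wealthS; have := le_trans (ler_norm _) hY; lra.
Qed.

Lemma wealth_bounded_all t : (t <= T)%N -> wealth_bounded t.
Proof.
elim: t => [|t IH] tT.
  by apply: aeW => om /=; exists `|w| => n; rewrite wealth0.
have wt := IH (ltnW tT); have := bounded_step tT wt.
move: wt; apply: filterS2 => om [B hB] [M hM].
exists (B + M * \sum_i `|incr Ss t.+1 om 0 i|) => n; rewrite wealthS.
rewrite (le_trans (ler_normD _ _))// lerD//; apply: le_norm_inner; exact: hM.
Qed.

Lemma strategy_bounded_all s : (1 <= s <= T)%N -> strategy_bounded s.
Proof.
case: s => // s /andP[_ sT]; apply: bounded_step => //.
exact/wealth_bounded_all/ltnW.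
Qed.

End BoundedStrategies.

End Market.

(** * Existence of the optimal strategy *)

Section Optimizer.
Context (R : realType) (d T : nat) (dO : measure_display) (Om : measurableType dO).
Variables (P : probability Om R) (F : nat -> set (set Om)).
Variable SS : set (nat -> Om -> 'rV[R]_d).
Hypothesis filtF : filtration P T F.
Hypothesis adaptS : forall S, SS S -> adapted T F S.
Variable Ss : nat -> Om -> 'rV[R]_d.
Hypothesis SsP : Sstar P T F SS Ss.
Variables (U : R -> \bar R) (w0 M : R).
Hypothesis UU : utility U.
Hypothesis M_ge0 : 0 <= M.
Hypothesis UM : forall x, (U x <= M%:E)%E.
Implicit Types (S phi : nat -> Om -> 'rV[R]_d).

(** Expected disutility: nonnegative because [M] bounds [U], so Fatou applies, and a lower bound on
    the worst case becomes an upper bound on all costs. *)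
Definition cost S phi : \bar R :=
  (\int[P]_om (M%:E - U (wealth S w0 phi T om)))%E.

Lemma cost_ge0 S phi : (0 <= cost S phi)%E.
Proof. by apply: integral_ge0 => om _; exact: disutility_ge0. Qed.

Lemma measurable_disutility S phi : SS S -> predictable T F phi ->
  measurable_fun setT (fun om => (M%:E - U (wealth S w0 phi T om))%E).
Proof.
move=> SSS mphi; apply: emeasurable_funB => //.
apply: (measurableT_comp (measurable_utility UU)).
exact: (measurable_wealth filtF adaptS _ SSS mphi).
Qed.

Lemma expect_cost S phi : SS S -> predictable T F phi ->
  expect P (fun om => U (wealth S w0 phi T om)) = (M%:E - cost S phi)%E.
Proof.
move=> SSS mphi; apply: expectE => //.
apply: (measurableT_comp (measurable_utility UU)).
exact: (measurable_wealth filtF adaptS _ SSS mphi).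
Qed.

Lemma le_worst_case (a : R) phi : predictable T F phi ->
  (a%:E <= worst_case P T SS U w0 phi)%E <->
  forall S, SS S -> (cost S phi <= (M - a)%:E)%E.
Proof.
move=> mphi.
have aE S : SS S -> (a%:E <= expect P (fun om => U (wealth S w0 phi T om)))%E =
    (cost S phi <= (M - a)%:E)%E.
  move=> SSS; rewrite expect_cost//; have := cost_ge0 S phi.
  case: (cost S phi) => [c| |]//= _.
  by rewrite -EFinB !lee_fin lerBrDl lerBrDl addrC.
split=> [h S SSS|h].
  by rewrite -aE//; apply: le_trans h _; apply: ereal_inf_lbound; exists S.
by apply: le_ereal_inf_tmp => _ [S SSS <-]; rewrite aE//; exact: h.
Qed.

Lemma worst_case_le phi : predictable T F phi -> (worst_case P T SS U w0 phi <= M%:E)%E.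
Proof.
move=> mphi; have [SSs _] := SsP.
apply: (@le_trans _ _ (expect P (fun om => U (wealth Ss w0 phi T om)))).
  by apply: ereal_inf_lbound; exists Ss.
rewrite expect_cost//; have := cost_ge0 Ss phi.
by case: (cost Ss phi) => [c| |]//= c0; rewrite ?leNye// -EFinB lee_fin gerBl.
Qed.

Lemma cost_ae S phi phi' : SS S -> predictable T F phi -> predictable T F phi' ->
  {ae P, forall om, wealth S w0 phi' T om = wealth S w0 phi T om} ->
  cost S phi' = cost S phi.
Proof.
move=> SSS mphi mphi' e; apply: ae_eq_integral => //.
- exact: measurable_disutility.
- exact: measurable_disutility.
- by move: e; apply: filterS => om -> _.
Qed.

Lemma cost_mid S phi psi (b : R) : SS S -> predictable T F phi -> predictable T F psi ->
  (cost S phi <= b%:E)%E -> (cost S psi <= b%:E)%E ->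
  (cost S (midstrat phi psi) <= b%:E)%E.
Proof.
move=> SSS mphi mpsi bphi bpsi.
have mh f : predictable T F f -> measurable_fun setT
    (fun om => 2^-1%:E * (M%:E - U (wealth S w0 f T om)))%E.
  by move=> mf; apply: measurable_funeM; exact: measurable_disutility.
have h0 f om : (0 <= 2^-1%:E * (M%:E - U (wealth S w0 f T om)))%E.
  by rewrite mule_ge0 ?disutility_ge0// lee_fin invr_ge0.
apply: (@le_trans _ _ (2^-1%:E * cost S phi + 2^-1%:E * cost S psi)%E).
  rewrite /cost -!ge0_integralZl_EFin ?invr_ge0//; try by
    [exact: measurable_disutility|move=> om _; exact: disutility_ge0].
  rewrite -ge0_integralD//; try by [exact: mh|move=> om _; exact: h0].
  apply: ge0_le_integral => //.
  - by move=> om _; exact: disutility_ge0.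
  - apply: measurable_disutility => //.
    apply/(predictableP filtF) => s sT; apply: gmeas_midvec.
      exact: (predictableP filtF _).1 mphi s sT.
    exact: (predictableP filtF _).1 mpsi s sT.
  - by apply: emeasurable_funD; exact: mh.
  - by move=> om _; rewrite wealth_mid; exact: disutility_mid.
move: (cost_ge0 S phi) (cost_ge0 S psi) bphi bpsi.
case: (cost S phi) => [x| |]//; case: (cost S psi) => [y| |]// _ _.
by rewrite -!EFinM -EFinD !lee_fin; lra.
Qed.

Variable v0 : R.
Hypothesis valE : value P T F SS U w0 = v0%:E.

Definition near_opt (n : nat) : set (nat -> Om -> 'rV[R]_d) :=
  [set phi | [/\ predictable T F phi, perp_strategy T P F Ss phi,
    forall S, SS S -> forall t, (t <= T)%N -> {ae P, forall om, 0 <= wealth S w0 phi t om} &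
    forall S, SS S -> (cost S phi <= (M - v0 + n.+1%:R^-1)%:E)%E]].

Lemma near_opt_nonempty n : exists phi, near_opt n phi.
Proof.
have : ((v0 - n.+1%:R^-1)%:E < value P T F SS U w0)%E.
  by rewrite valE lte_fin ltrBlDr ltrDl invr_gt0.
move=> /ereal_sup_gt[_ [phi [mphi aphi] <-] /ltW].
move=> /(le_worst_case _ mphi) cphi.
have [phi' [mphi' pphi' wE]] := perp_strategy_exists filtF adaptS SsP mphi.
exists phi'; split => //.
  move=> S SSS t tT; have [_ /(_ t tT)] := aphi S SSS.
  by have := wE S SSS w0; apply: filterS2 => om h1 h2; rewrite h1.
move=> S SSS; rewrite (@cost_ae S phi)//.
  by apply: le_trans (cphi S SSS) _; rewrite lee_fin opprB addrCA addrC.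
by have := wE S SSS w0; apply: filterS => om; apply.
Qed.

Lemma near_opt_dec n : near_opt n.+1 `<=` near_opt n.
Proof.
move=> phi [? ? ? h]; split => // S SSS; apply: le_trans (h S SSS) _.
by rewrite lee_fin lerD2l lef_pV2 ?posrE// ler_nat.
Qed.

Lemma near_opt_mid n phi psi : near_opt n phi -> near_opt n psi ->
  near_opt n (midstrat phi psi).
Proof.
move=> [mphi pphi aphi cphi] [mpsi ppsi apsi cpsi]; split.
- apply/(predictableP filtF) => s sT; apply: gmeas_midvec.
    exact: (predictableP filtF _).1 mphi s sT.
  exact: (predictableP filtF _).1 mpsi s sT.
- move=> s sT nu nnu; move: (pphi s sT nu nnu) (ppsi s sT nu nnu).
  by apply: filterS2 => om; rewrite inner_midvec => -> ->; rewrite addr0 mul0r.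
- move=> S SSS t tT; move: (aphi S SSS t tT) (apsi S SSS t tT).
  by apply: filterS2 => om h1 h2; rewrite wealth_mid divr_ge0// addr_ge0.
- by move=> S SSS; apply: cost_mid => //; [exact: cphi|exact: cpsi].
Qed.

(** Ordinals start at 0 while trading periods run from 1 to [T], hence the successor. *)
Definition strat_coord phi (si : 'I_T * 'I_d) (om : Om) : R := phi si.1.+1 om 0 si.2.

Lemma measurable_strat_coord phi si : predictable T F phi ->
  measurable_fun setT (strat_coord phi si).
Proof.
by move=> mphi; apply: (measurable_strategy filtF mphi); rewrite ltn_ord.
Qed.

(** One near-optimal strategy is fixed for each [n]; the weight is built from the pointwise supremum
    of this single sequence, so that each of its members has norm at most 1. *)
Lemma near_opt_weight : exists w : Om -> R, [/\ forall om, 0 < w om,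
  measurable_fun setT w &
  forall n, exists2 phi, near_opt n phi & (wnorm P strat_coord w phi <= 1%:E)%E].
Proof.
have /choice[Phi PhiP] := near_opt_nonempty.
have mPhi n : predictable T F (Phi n) by have [] := PhiP n.
have bPhi : {ae P, forall om, forall si, exists B : R, forall n,
    `|strat_coord (Phi n) si om| <= B}.
  apply: ae_forall_countable => -[s i].
  have sT : (1 <= s.+1 <= T)%N by rewrite ltn_ord.
  have pPhi n : perp_strategy T P F Ss (Phi n) by have [] := PhiP n.
  have wPhi n t : (t <= T)%N -> {ae P, forall om, 0 <= wealth Ss w0 (Phi n) t om}.
    by move=> tT; have [_ _ + _] := PhiP n; apply => //; exact: SsP.1.
  have := strategy_bounded_all filtF SsP mPhi pPhi wPhi sT.
  by apply: filterS => om [B hB]; exists B => n; exact: hB.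
(* Pointwise boundedness only provides some bound for each outcome; the supremum over [n] is a
   measurable one. *)
pose Z si om : \bar R := esups (fun n => `|strat_coord (Phi n) si om|%:E) 0.
have mZ si : measurable_fun setT (Z si).
  apply: measurable_fun_esups => n; apply/measurable_EFinP.
  by apply: measurableT_comp => //; exact: measurable_strat_coord.
pose q om : R := \sum_si (fine (Z si om)) ^+ 2.
have q0 om : 0 <= q om by apply: sumr_ge0 => si _; rewrite sqr_ge0.
pose w om : R := (1 + q om)^-1.
have w_gt0 om : 0 < w om by rewrite invr_gt0 ltr_pwDl.
have mw : measurable_fun setT w.
  apply: (measurableT_comp (@measurable_invr R)).
  apply: measurable_funD => //; apply: measurable_sum => si.
  by apply: measurable_funX; exact: measurableT_comp.
exists w; split => // n; exists (Phi n) => //.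
apply: (@le_trans _ _ (\int[P]_om (cst 1%:E om))%E); last first.
  by rewrite integral_cst//= mul1e probability_setT.
apply: ae_ge0_le_integral => //.
- by move=> om _; rewrite lee_fin wsq_ge0.
- apply/measurable_EFinP; apply: measurable_wsq => // si.
  exact: measurable_strat_coord.
move: bPhi; apply: filterS => om hB _; rewrite lee_fin /wsq /w mulrC.
rewrite ler_pdivrMr ?mul1r ?ltr_pwDl//.
apply: (@le_trans _ _ (q om)); last by rewrite lerDr ler01.
apply: ler_sum => si _.
have [B hsi] := hB si.
have Zle m : (`|strat_coord (Phi m) si om|%:E <= Z si om)%E.
  by apply: ereal_sup_ubound; exists m.
have Zfin : Z si om \is a fin_num.
  rewrite ge0_fin_numE; last exact: le_trans (Zle 0%N).
  apply: (@le_lt_trans _ _ B%:E); last exact: ltry.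
  by apply: ge_ereal_sup => _ [m _ <-]; rewrite lee_fin.
rewrite -real_normK ?num_real//; apply: lerXn2r; rewrite ?nnegrE//.
  by rewrite fine_ge0//; exact: le_trans (Zle 0%N).
by rewrite -lee_fin fineK.
Qed.

Lemma optimizer_exists : exists phihat, Adm P T F SS w0 phihat /\
  forall S, SS S -> (cost S phihat <= (M - v0)%:E)%E.
Proof.
have [w [w_gt0 mw wP]] := near_opt_weight.
have [v [vC vcvg _]] : exists v : nat -> nat -> Om -> 'rV[R]_d,
    [/\ forall n, near_opt n (v n),
    {ae P, forall om, forall si, cvgn (fun n => strat_coord (v n) si om)} &
    forall r : R, (forall n, exists2 x, near_opt n x &
      (wnorm P strat_coord w x <= r%:E)%E) ->
      forall k, (wnorm P strat_coord w (v k) <= (r + 16^-1 ^+ k.+1)%:E)%E].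
  apply: (@near_minimizers_cvg _ _ _ P _ _ strat_coord (@midstrat _ _ _ _) w _
    w_gt0 mw near_opt 1) => //.
  - by move=> x y si om; exact: midvecE.
  - exact: near_opt_dec.
  - exact: near_opt_mid.
  - by move=> n x [mx _ _ _] si; exact: measurable_strat_coord.
have mv n : predictable T F (v n) by have [] := vC n.
(* Limits are taken period by period, each measurable for its own [F s.-1]; outside the trading
   periods the value 0 is arbitrary. *)
have /choice[phi phiP] : forall s, exists g, (1 <= s <= T)%N ->
    gmeas (F s.-1) g /\
    {ae P, forall om, forall i, (fun n => v n s om 0 i) @ \oo --> g om 0 i}.
  move=> [|s]; first by exists (fun=> 0).
  have [sT|] := boolP (1 <= s.+1 <= T)%N; last by exists (fun=> 0).
  have [] := @gmeas_ae_lim _ _ _ _ P (F s) (fun n => v n s.+1).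
  - by move=> n; exact: (predictableP filtF _).1 (mv n) _ sT.
  - move: vcvg; apply: filterS => om h i; exact: (h (Ordinal sT, i)).
  by move=> g mg vg; exists g.
have mphi : predictable T F phi.
  by apply/(predictableP filtF) => s /phiP[].
have cphi : {ae P, forall om, forall s, (1 <= s <= T)%N ->
    forall i, (fun n => v n s om 0 i) @ \oo --> phi s om 0 i}.
  apply: ae_foralln => s; have [sT|] := boolP (1 <= s <= T)%N; last first.
    by move=> _; apply: aeW.
  by have [_] := phiP s sT; apply: filterS => om h _.
have cw S t : (t <= T)%N -> {ae P, forall om,
    (fun n => wealth S w0 (v n) t om) @ \oo --> wealth S w0 phi t om}.
  move=> tT; move: cphi; apply: filterS => om h; apply: cvg_wealth.
  by move=> s /andP[s1 st]; apply: h; rewrite s1 (leq_trans st).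
exists phi; split.
  split => // S SSS; split => // t tT.
  have : {ae P, forall om, forall n, 0 <= wealth S w0 (v n) t om}.
    by apply: ae_foralln => n; have [_ _ + _] := vC n; exact.
  move: (cw S t tT); apply: filterS2 => om cvw h.
  rewrite -(cvg_lim (@Rhausdorff R) cvw); apply: limr_ge.
    by apply/cvg_ex; eexists; exact: cvw.
  exact: nearW.
move=> S SSS.
apply: (@fatou_ae_le _ _ _ _ (fun n om => M%:E - U (wealth S w0 (v n) T om))%E _
   (fun n => M - v0 + n.+1%:R^-1)).
- by move=> n; exact: measurable_disutility.
- exact: measurable_disutility.
- by move=> n om; exact: disutility_ge0.
- by move=> om; exact: disutility_ge0.
- move: (cw S T (leqnn _)); apply: filterS => om; exact: disutility_lsc.
- by move=> n; have [_ _ _] := vC n; exact.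
- rewrite -[X in _ --> X]addr0; apply: cvgD; first exact: cvg_cst.
  exact: cvg_harmonic.
Qed.

End Optimizer.

Unset Implicit Arguments.

Theorem theorem3p2 (R : realType) (d T : nat) (dO : measure_display)
  (Om : measurableType dO) (P : probability Om R) (F : nat -> set (set Om))
  (SS : set (nat -> Om -> 'rV[R]_d)) (U : R -> \bar R) (w0 : R) :
  filtration P T F ->
  (forall S, SS S -> adapted T F S) ->
  (exists Ss, Sstar P T F SS Ss) ->
  utility U ->
  positive_domain U ->
  0 < w0 ->
  (lim (U x @[x --> +oo%R]) < +oo)%E ->
  exists phihat, Adm P T F SS w0 phihat /\
    value P T F SS U w0 = worst_case P T SS U w0 phihat /\
    (worst_case P T SS U w0 phihat < +oo)%E.
Proof.
move=> filtF adaptS [Ss SsP] UU posU w0_gt0 limU.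
have [M M0 UM] := utility_bounded UU limU.
have Uw0 : (-oo < U w0)%E.
  have : [set x : R | 0 < x] w0 by [].
  by rewrite -posU => /interior_subset.
have m0 : predictable T F (fun _ _ => 0 : 'rV[R]_d).
  apply/(predictableP filtF) => s sT i.
  under eq_fun do rewrite mxE; exact: measurable_cst.
have adm0 : Adm P T F SS w0 (fun _ _ => 0).
  split => // S SSS; split => // t tT; apply: aeW => om /=.
  by rewrite wealth_zero ltW.
have val_le : (value P T F SS U w0 <= M%:E)%E.
  by apply: ge_ereal_sup => _ [phi [mphi _] <-]; exact: (worst_case_le filtF adaptS SsP _ UU).
(* The zero strategy keeps the wealth at [w0], so its worst case is at least [U w0]. With the bound
   [M] this makes the value finite, as [optimizer_exists] requires. *)
have val_ge : (U w0 <= value P T F SS U w0)%E.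
  apply: (@le_trans _ _ (worst_case P T SS U w0 (fun _ _ => 0))); last first.
    by apply: ereal_sup_ubound; exists (fun _ _ => 0).
  have [Uy _] := UU; case uE : (U w0) Uw0 (Uy w0) => [u| |]// _ _.
  apply/(le_worst_case filtF adaptS _ UU M0 UM) => // S SSS.
  rewrite /cost; under eq_integral do rewrite wealth_zero uE -EFinB.
  by rewrite integral_cst//= probability_setT mule1.
have [v0 valE] : exists v0, value P T F SS U w0 = v0%:E.
  move: val_le val_ge Uw0; case: (value _ _ _ _ _ _) => [v| |]//; first by exists v.
  by rewrite leeNy_eq => _ /eqP ->; rewrite ltxx.
have [phi [aphi cphi]] := optimizer_exists filtF adaptS SsP UU M0 UM valE.
exists phi; split => //; split.
  apply/eqP; rewrite eq_le; apply/andP; split; last first.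
    by apply: ereal_sup_ubound; exists phi.
  by rewrite valE; apply/(le_worst_case filtF adaptS _ UU M0 UM) => //; exact: aphi.1.
apply: le_lt_trans (ltry M); exact: (worst_case_le filtF adaptS SsP _ UU M0 UM aphi.1).
Qed.
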